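(* Let $\rho$ be an action of a symmetric graded Lie algebra $(\mathfrak g,[\cdot,\cdot]_{\mathfrak g})$ on a symmetric graded Lie algebra $(\mathfrak h,[\cdot,\cdot]_{\mathfrak h})$, let $\lambda$ be a constant in the ground field, and let $C^*(\mathfrak h,\mathfrak g):=\oplus_{n\in\mathbb Z}\mathrm{Hom}^n(S(\mathfrak h),\mathfrak g)$. Define $\mathrm d:\mathrm{Hom}^n(S(\mathfrak h),\mathfrak g)\to \mathrm{Hom}^{n+1}(S(\mathfrak h),\mathfrak g)$ by $$(\mathrm d g)_p(v_1,\dots,v_p)=\sum_{1\le i<j\le p}(-1)^{n+1+v_i(v_1+\cdots+v_{i-1})+v_j(v_1+\cdots+v_{j-1})+v_iv_j}\,g_{p-1}(\lambda[v_i,v_j]_{\mathfrak h},v_1,\dots,\hat v_i,\dots,\hat v_j,\dots,v_p),$$ and $\{\!\{\cdot,\cdot\}\!\}:\mathrm{Hom}^m(S(\mathfrak h),\mathfrak g)\times\mathrm{Hom}^n(S(\mathfrak h),\mathfrak g)\to\mathrm{Hom}^{m+n+1}(S(\mathfrak h),\mathfrak g)$ by $$\begin{aligned}\{\!\{f,g\}\!\}_p(v_1,\dots,v_p)=&-\sum_{k+l=p+1}\sum_{\sigma\in\mathbb S_{(l,1,p-l-1)}}\varepsilon(\sigma)f_{k-1}\Big(\rho\big(g_l(v_{\sigma(1)},\dots,v_{\sigma(l)})\big)v_{\sigma(l+1)},v_{\sigma(l+2)},\dots,v_{\sigma(p)}\Big)\\&+(-1)^{(m+1)(n+1)}\sum_{k+l=p+1}\sum_{\sigma\in\mathbb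 S_{(k-1,1,p-k)}}\varepsilon(\sigma)g_l\Big(\rho\big(f_{k-1}(v_{\sigma(1)},\dots,v_{\sigma(k-1)})\big)v_{\sigma(k)},v_{\sigma(k+1)},\dots,v_{\sigma(p)}\Big)\\&-\sum_{k+l=p+1}\sum_{\sigma\in\mathbb S_{(k-1,l)}}(-1)^{n(v_{\sigma(1)}+\cdots+v_{\sigma(k-1)})+m+1}\varepsilon(\sigma)[f_{k-1}(v_{\sigma(1)},\dots,v_{\sigma(k-1)}),g_l(v_{\sigma(k)},\dots,v_{\sigma(p)})]_{\mathfrak g}\end{aligned}$$ for $f=\sum_if_i\in\mathrm{Hom}^m(S(\mathfrak h),\mathfrak g)$, $g=\sum_ig_i\in\mathrm{Hom}^n(S(\mathfrak h),\mathfrak g)$ and homogeneous $v_1,\dots,v_p\in\mathfrak h$. Then $(sC^*(\mathfrak h,\mathfrak g),\{\!\{\cdot,\cdot\}\!\},\mathrm d)$ is a differential graded Lie algebra.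
   Context: All vector spaces are over a field of characteristic zero; graded means $\mathbb Z$-graded. For a homogeneous element $x$, the symbol $x$ in an exponent of $-1$ denotes its degree. For a graded vector space $V$, $S(V)=\oplus_{i\ge0}S^i(V)$ is the (graded-commutative) symmetric algebra with product $\odot$. The Koszul sign $\varepsilon(\sigma)=\varepsilon(\sigma;v_1,\dots,v_n)$ is defined by $v_1\odot\cdots\odot v_n=\varepsilon(\sigma)\,v_{\sigma(1)}\odot\cdots\odot v_{\sigma(n)}$. $\mathbb S_{(i_1,\dots,i_k)}$ is the set of $(i_1,\dots,i_k)$-shuffles, i.e. permutations of $\{1,\dots,i_1+\cdots+i_k\}$ increasing on each of the consecutive blocks of sizes $i_1,\dots,i_k$ (the set is empty if some $i_j<0$). $\mathrm{Hom}^n(S(V),W)$ is the space of degree $n$ linear maps $S(V)\to W$; such $f$ is written $f=\sum_{i\ge0}f_i$ with $f_i:S^i(V)\to W$ ($f_0$ is an element of $W^n$). In sums over $k+l=p+1$, $k\ge1$ and $l\ge0$. A subscript $p$ (as in $(\mathrm dg)_p$) denotes the component on $S^p$. A symmetric graded Lie algebra (sgLa) is a graded vector space $\mathfrak g$ with a bilinear bracket $[\cdot,\cdot]_{\mathfrak g}$ of degree $1$ such that $[x,y]_{\mathfrak g}=(-1)^{xy}[y,x]_{\mathfrak g}$ and $[x,[y,z]_{\mathfrak g}]_{\mathfrak g}=(-1)^{x+1}[[x,y]_{\mathfrak g},z]_{\mathfrak g}+(-1)^{(x+1)(y+1)}[y,[x,z]_{\mathfrak g}]_{\mathfrak g}$.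 A homomorphism of sgLa's is a degree $0$ linear map preserving brackets. A derivation of degree $n$ of a sgLa $\mathfrak h$ is a degree $n$ linear map $D$ with $D[x,y]_{\mathfrak h}=(-1)^n[Dx,y]_{\mathfrak h}+(-1)^{n(x+1)}[x,Dy]_{\mathfrak h}$; $\mathrm{Der}(\mathfrak h)=\oplus_n\mathrm{Der}^n(\mathfrak h)$. Suspension: $(sV)^i=V^{i-1}$, $(s^{-1}V)^i=V^{i+1}$, with the identity-on-underlying-spaces maps $s:V\to sV$ (degree $1$) and $s^{-1}:V\to s^{-1}V$ (degree $-1$). $s^{-1}\mathrm{Der}(\mathfrak h)$ is a sgLa with $[s^{-1}f,s^{-1}g]:=(-1)^m s^{-1}[f,g]$ for $f$ of degree $m$, $[f,g]$ being the graded commutator. An action of a sgLa $\mathfrak g$ on a sgLa $\mathfrak h$ is a degree $1$ linear map $\rho:\mathfrak g\to\mathrm{Der}(\mathfrak h)$ such that $s^{-1}\circ\rho:\mathfrak g\to s^{-1}\mathrm{Der}(\mathfrak h)$ is a sgLa homomorphism. The operations $\mathrm d$ and $\{\!\{\cdot,\cdot\}\!\}$ are transported to the suspension $sC^*(\mathfrak h,\mathfrak g)$ (where $\mathrm{Hom}^n(S(\mathfrak h),\mathfrak g)$ sits in degree $n+1$) by identifying $sf$ with $f$. *)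

(* Defs.v *)
From HB Require Import structures.
From mathcomp Require Import all_boot all_order all_fingroup all_algebra.
From mathcomp Require Import generic_quotient ring_quotient.
From mathcomp Require Import boolp classical_sets functions.
From mathcomp Require Import monalg.

Set Implicit Arguments.
Unset Strict Implicit.
Unset Printing Implicit Defensive.

Import GRing.Theory.

Local Open Scope ring_scope.
Local Open Scope quotient_scope.

(** * Graded vector spaces *)

(* A vector space with a Z-indexed family of subsets [homog V n] = V^n.  The
   condition that V is the direct sum of the V^n is the predicate [graded]. *)
Record gspace (K : fieldType) := GSpace {
  gcarrier :> lmodType K;
  homog : int -> set gcarrier }.
Arguments homog {K} _ _.

Inductive span_of (K : fieldType) (M : lmodType K) (A : int -> set M) :
    set M :=
| span_of0 : span_of A 0
| span_ofD n c x y : A n x -> span_of A y -> span_of A (c *: x + y).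

Definition graded (K : fieldType) (V : gspace K) : Prop :=
  [/\ forall n, homog V n 0,
      forall n c x y, homog V n x -> homog V n y -> homog V n (c *: x + y),
      forall x : V, span_of (homog V) x &
      forall (s : seq int) (x : int -> V), uniq s ->
        (forall n, homog V n (x n)) -> \sum_(n <- s) x n = 0 ->
        forall n, n \in s -> x n = 0].

(* (sV)^n = V^(n-1) and (s^-1 V)^n = V^(n+1); the maps s and s^-1 are the
   identity of the underlying space. *)
Definition susp (K : fieldType) (V : gspace K) : gspace K :=
  @GSpace K V (fun n => homog V (n - 1)).
Definition desusp (K : fieldType) (V : gspace K) : gspace K :=
  @GSpace K V (fun n => homog V (n + 1)).

Definition span_pred (K : fieldType) (M : lmodType K) (A : int -> set M) :
  {pred M} := fun x => `[< span_of A x >].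

Section SpanClosed.
Variables (K : fieldType) (M : lmodType K) (A : int -> set M).

Lemma span_of_lin c (x y : M) :
  span_of A x -> span_of A y -> span_of A (c *: x + y).
Proof.
move=> sx sy; elim: sx => [|n b u v Au _ IH]; first by rewrite scaler0 add0r.
by rewrite scalerDr scalerA -addrA; exact: span_ofD Au IH.
Qed.

Lemma span_pred_closed : submod_closed (span_pred A).
Proof.
split=> [|c x y]; first by apply/asboolP; exact: span_of0.
move=> /asboolP sx /asboolP sy; apply/asboolP.
exact: span_of_lin.
Qed.

HB.instance Definition _ :=
  GRing.isSubmodClosed.Build K M (span_pred A) span_pred_closed.

(* The sum, inside M, of the subspaces A n, as a vector space of its own. *)
Record gsum_type := GSum { gsum_val :> M; _ : gsum_val \in span_pred A }.

HB.instance Definition _ := [isSub for gsum_val].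
HB.instance Definition _ := [Choice of gsum_type by <:].
HB.instance Definition _ := [SubChoice_isSubLmodule of gsum_type by <:].

Definition gsum : gspace K :=
  @GSpace K gsum_type (fun n x => A n (gsum_val x)).

End SpanClosed.

(* Linear maps V -> W of degree n, and Hom(V, W), the sum over n of these
   (inside the space of all functions V -> W). *)
Definition hom_deg (K : fieldType) (V W : gspace K) (n : int) : set (V -> W) :=
  [set f | linear f /\ forall i x, homog V i x -> homog W (i + n) (f x)]%classic.

Definition gHom (K : fieldType) (V W : gspace K) : gspace K :=
  gsum (@hom_deg K V W).

Definition bilinear_deg (K : fieldType) (V : gspace K) (n : int)
    (b : V -> V -> V) : Prop :=
  [/\ forall x, linear (b x), forall y, linear (b ^~ y) &
      forall i j x y, homog V i x -> homog V j y ->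
        homog V (i + j + n) (b x y)].

(** * The symmetric algebra *)

Lemma malg_scalerAr (M : monomType) (R : comNzRingType) (c : R)
  (x y : {malg R[M]}) : c *: (x * y) = x * (c *: y).
Proof.
apply/malgP => k; rewrite mcoeffZ mcoeffMl.
rewrite (mcoeffMlw _ (finmap.fsubset_refl _) (msuppZ_le c y)) mulr_sumr.
apply: eq_bigr => k1 _; rewrite mulr_sumr; apply: eq_bigr => k2 _.
by rewrite mcoeffZ mulrnAr mulrCA.
Qed.

(* S(V) is the quotient of the free associative algebra on the set V by the
   two-sided ideal generated by the relations making V -> S(V) linear and by
   u v - (-1)^(ij) v u, for u in V^i and v in V^j. *)
Section SymmetricIdeal.
Variables (K : fieldType) (V : gspace K).

Local Notation T := ({malg K[{fmonom V}]}).

Definition letter (x : V) : T := << fmu x >>.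

Inductive sym_rel : set T :=
| sym_rel_lin c u v :
    sym_rel (letter (c *: u + v) - (c *: letter u + letter v))
| sym_rel_comm i j u v : homog V i u -> homog V j v ->
    sym_rel (letter u * letter v - (-1) ^ (i * j) *: (letter v * letter u)).

Inductive sym_ideal : set T :=
| sym_ideal0 : sym_ideal 0
| sym_idealD a r b y :
    sym_rel r -> sym_ideal y -> sym_ideal (a * r * b + y).

Lemma sym_ideal_gen r : sym_rel r -> sym_ideal r.
Proof.
move=> hr; have := sym_idealD 1 1 hr sym_ideal0.
by rewrite addr0 mulr1 mul1r.
Qed.

Definition sym_ideal_pred : {pred T} := fun x => `[< sym_ideal x >].

Lemma sym_ideal_add x y : sym_ideal x -> sym_ideal y -> sym_ideal (x + y).
Proof.
move=> sx sy; elim: sx => [|a r b z ? _ IH]; first by rewrite add0r.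
by rewrite -addrA; apply: sym_idealD.
Qed.

Lemma sym_ideal_mull a x : sym_ideal x -> sym_ideal (a * x).
Proof.
elim=> [|c r b z ? _ IH]; first by rewrite mulr0; apply: sym_ideal0.
by rewrite mulrDr !mulrA; apply: sym_idealD.
Qed.

Lemma sym_ideal_mulr a x : sym_ideal x -> sym_ideal (x * a).
Proof.
elim=> [|c r b z ? _ IH]; first by rewrite mul0r; apply: sym_ideal0.
by rewrite mulrDl -[_ * b * a]mulrA; apply: sym_idealD.
Qed.

Lemma sym_ideal_scale c x : sym_ideal x -> sym_ideal (c *: x).
Proof.
by move=> sx; rewrite -[x]mul1r scalerAl; apply: sym_ideal_mull.
Qed.

Lemma sym_ideal_zmod : zmod_closed sym_ideal_pred.
Proof.
split=> [|x y]; first by apply/asboolP; exact: sym_ideal0.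
move=> /asboolP sx /asboolP sy; apply/asboolP.
by rewrite -scaleN1r; apply: sym_ideal_add => //; apply: sym_ideal_scale.
Qed.

HB.instance Definition _ :=
  GRing.isZmodClosed.Build T sym_ideal_pred sym_ideal_zmod.

Definition sym_type := Quotient.quot sym_ideal_pred.

HB.instance Definition _ := GRing.Zmodule.on sym_type.
HB.instance Definition _ := Quotient.on sym_type.

End SymmetricIdeal.

(* Locked, so that unification does not unfold the quotient and the free
   algebra. *)
HB.lock Definition sym_pi (K : fieldType) (V : gspace K)
  (x : {malg K[{fmonom V}]}) : sym_type V := \pi_(sym_type V) x.

HB.lock Definition sym_scale (K : fieldType) (V : gspace K) (c : K)
  (x : sym_type V) : sym_type V := sym_pi (c *: repr x).

HB.lock Definition sym_mul (K : fieldType) (V : gspace K)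
  (x y : sym_type V) : sym_type V := sym_pi (repr x * repr y).

HB.lock Definition sym_in (K : fieldType) (V : gspace K) (x : V) :
  sym_type V := sym_pi (letter x).

Section SymmetricAlgebra.
Variables (K : fieldType) (V : gspace K).

Local Notation T := ({malg K[{fmonom V}]}).
Local Notation sym_type := (sym_type V).
Local Notation sym_mul := (@sym_mul K V).
Local Notation sym_scale := (@sym_scale K V).
Local Notation sym_pi := (@sym_pi K V).
Local Notation sym_in := (@sym_in K V).

Lemma sym_pi_eq x y : sym_pi x = sym_pi y <-> sym_ideal (x - y).
Proof.
rewrite sym_pi.unlock; split=> [/eqP|h]; last apply/eqP.
  by rewrite -Quotient.idealrBE => /asboolP.
by rewrite -Quotient.idealrBE; apply/asboolP.
Qed.

Lemma sym_piK (x : sym_type) : sym_pi (repr x) = x.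
Proof. by rewrite sym_pi.unlock; apply: reprK. Qed.

Lemma sym_piD x y : sym_pi (x + y) = sym_pi x + sym_pi y.
Proof. by rewrite sym_pi.unlock !piE. Qed.

Lemma sym_pi_scale c x : sym_scale c (sym_pi x) = sym_pi (c *: x).
Proof.
rewrite sym_scale.unlock; apply/sym_pi_eq; rewrite -scalerBr.
exact/sym_ideal_scale/sym_pi_eq/sym_piK.
Qed.

Lemma sym_pi_mul x y : sym_mul (sym_pi x) (sym_pi y) = sym_pi (x * y).
Proof.
rewrite sym_mul.unlock; apply/sym_pi_eq; set x' := repr _; set y' := repr _.
have hx : sym_ideal (x' - x) by apply/sym_pi_eq/sym_piK.
have hy : sym_ideal (y' - y) by apply/sym_pi_eq/sym_piK.
have -> : x' * y' - x * y = (x' - x) * y' + x * (y' - y).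
  by rewrite mulrBl mulrBr addrA subrK.
by apply: sym_ideal_add; [apply: sym_ideal_mulr | apply: sym_ideal_mull].
Qed.

Lemma sym_scaleA a b v : sym_scale a (sym_scale b v) = sym_scale (a * b) v.
Proof. by rewrite -[v]sym_piK !sym_pi_scale scalerA. Qed.
Lemma sym_scale1 : left_id 1 sym_scale.
Proof. by move=> v; rewrite -[v]sym_piK sym_pi_scale scale1r. Qed.
Lemma sym_scaleDr : right_distributive sym_scale +%R.
Proof.
move=> a u v; rewrite -[u]sym_piK -[v]sym_piK.
by rewrite -sym_piD !sym_pi_scale -sym_piD scalerDr.
Qed.
Lemma sym_scaleDl v : {morph sym_scale^~ v : a b / a + b}.
Proof.
by move=> a b; rewrite -[v]sym_piK !sym_pi_scale -sym_piD scalerDl.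
Qed.

HB.instance Definition _ := GRing.Zmodule_isLmodule.Build K sym_type
  sym_scaleA sym_scale1 sym_scaleDr sym_scaleDl.

Lemma sym_mulA : associative sym_mul.
Proof.
move=> x y z; rewrite -[x]sym_piK -[y]sym_piK -[z]sym_piK.
by rewrite !sym_pi_mul mulrA.
Qed.
Lemma sym_mul1l : left_id (sym_pi 1) sym_mul.
Proof. by move=> x; rewrite -[x]sym_piK sym_pi_mul mul1r. Qed.
Lemma sym_mul1r : right_id (sym_pi 1) sym_mul.
Proof. by move=> x; rewrite -[x]sym_piK sym_pi_mul mulr1. Qed.
Lemma sym_mulDl : left_distributive sym_mul +%R.
Proof.
move=> x y z; rewrite -[x]sym_piK -[y]sym_piK -[z]sym_piK.
by rewrite -sym_piD !sym_pi_mul -sym_piD mulrDl.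
Qed.
Lemma sym_mulDr : right_distributive sym_mul +%R.
Proof.
move=> x y z; rewrite -[x]sym_piK -[y]sym_piK -[z]sym_piK.
by rewrite -sym_piD !sym_pi_mul -sym_piD mulrDr.
Qed.

HB.instance Definition _ := GRing.Zmodule_isPzRing.Build sym_type
  sym_mulA sym_mul1l sym_mul1r sym_mulDl sym_mulDr.

Lemma sym_piZ c x : sym_pi (c *: x) = c *: sym_pi x.
Proof. by rewrite -sym_pi_scale. Qed.
Lemma sym_piM x y : sym_pi (x * y) = sym_pi x * sym_pi y.
Proof. by rewrite -sym_pi_mul. Qed.

Definition sym_prod (s : seq V) : sym_type := \prod_(x <- s) sym_in x.

(* S(V)^d is spanned by the products of homogeneous elements of total degree d;
   an entry (i, x) of the sequence is an x in V^i. *)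
Definition sym_homog (d : int) : set sym_type :=
  span_of (fun _ => [set x | exists s : seq (int * V),
    [/\ forall q, q \in s -> homog V q.1 q.2, \sum_(q <- s) q.1 = d &
        x = sym_prod (unzip2 s)]]%classic).

Definition Sym : gspace K := @GSpace K sym_type sym_homog.

End SymmetricAlgebra.

(** * Symmetric graded Lie algebras, derivations, actions *)

Definition is_sgLa (K : fieldType) (V : gspace K) (b : V -> V -> V) : Prop :=
  [/\ graded V, bilinear_deg 1 b,
      forall i j x y, homog V i x -> homog V j y ->
        b x y = (-1) ^ (i * j) *: b y x &
      forall i j k x y z, homog V i x -> homog V j y -> homog V k z ->
        b x (b y z) = (-1) ^ (i + 1) *: b (b x y) z
                      + (-1) ^ ((i + 1) * (j + 1)) *: b y (b x z)].

Record sgLa (K : fieldType) := SgLa {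
  sgLa_space :> gspace K;
  sgLa_bracket : sgLa_space -> sgLa_space -> sgLa_space;
  sgLaP : is_sgLa sgLa_bracket }.
Arguments sgLa_bracket {K s} _ _.

Local Notation "[sg x , y ]" := (sgLa_bracket x y)
  (at level 0, x, y at level 9, format "[sg  x ,  y ]").

Definition der_deg (K : fieldType) (h : sgLa K) (n : int) : set (h -> h) :=
  [set D | hom_deg n D /\
    forall i j x y, homog h i x -> homog h j y ->
      D [sg x, y] = (-1) ^ n *: [sg (D x), y]
                    + (-1) ^ (n * (i + 1)) *: [sg x, (D y)]]%classic.

Definition Der (K : fieldType) (h : sgLa K) : gspace K := gsum (@der_deg K h).

Definition der_fun (K : fieldType) (h : sgLa K) (D : Der h) : h -> h :=
  gsum_val D.

(* [f, g] for f of degree m and g of degree n *)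
Definition gcomm (K : fieldType) (V : gspace K) (m n : int) (f g : V -> V) :
  V -> V := fun v => f (g v) - (-1) ^ (m * n) *: g (f v).

(* [s^-1 f, s^-1 g] in s^-1 Der(h), for f in Der^m(h) and g in Der^n(h) *)
Definition sder_bracket (K : fieldType) (h : sgLa K) (m n : int)
    (f g : Der h) : h -> h :=
  fun v => (-1) ^ m *: gcomm m n (der_fun f) (der_fun g) v.

(* s^-1 o rho is a map of degree 0 to s^-1 Der(h) which preserves brackets; an
   element of degree i of g goes to s^-1 D with D in Der^(i+1)(h). *)
Definition is_action (K : fieldType) (g h : sgLa K) (rho : g -> Der h) : Prop :=
  hom_deg (W := desusp (Der h)) 0 rho /\
  forall i j x y, homog g i x -> homog g j y ->
    der_fun (rho [sg x, y]) = sder_bracket (i + 1) (j + 1) (rho x) (rho y).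

(** * Differential graded Lie algebras *)

Definition is_dgLa (K : fieldType) (L : gspace K) (b : L -> L -> L)
    (d : L -> L) : Prop :=
  [/\ graded L, bilinear_deg 0 b, hom_deg 1 d &
  [/\
      forall i j x y, homog L i x -> homog L j y ->
        b x y = - ((-1) ^ (i * j) *: b y x),
      forall i j k x y z, homog L i x -> homog L j y -> homog L k z ->
        b x (b y z) = b (b x y) z + (-1) ^ (i * j) *: b y (b x z),
      forall x, d (d x) = 0 &
      forall i j x y, homog L i x -> homog L j y ->
        d (b x y) = b (d x) y + (-1) ^ i *: b x (d y)]].

(** * Shuffles and Koszul signs *)

(* The blocks have sizes given by bs; the position i lies in the block number
   [reshape_index sh i], and [shuffle bs s] is false if some size is negative. *)
Definition shuffle (p : nat) (bs : seq int) (s : 'S_p) : bool :=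
  let sh := [seq `|b|%N | b <- bs] in
  [&& all (fun b => 0 <= b) bs, \sum_(b <- bs) b == p%:Z &
      [forall i : 'I_p, forall j : 'I_p,
         (i < j)%N && (reshape_index sh i == reshape_index sh j)
           ==> (s i < s j)%N]].

(* The Koszul sign for elements v_i of degrees a i; see [koszulE]. *)
Definition koszul (K : fieldType) (p : nat) (s : 'S_p) (a : 'I_p -> int) : K :=
  \prod_(i < p) \prod_(j < p | (i < j)%N && (s j < s i)%N)
    (-1) ^ (a (s i) * a (s j)).

Section KoszulSign.
Variables (K : fieldType) (V : gspace K).

Lemma sym_in_linear : linear (@sym_in K V).
Proof.
move=> c u v; rewrite sym_in.unlock -sym_piZ -sym_piD.
by apply/sym_pi_eq/sym_ideal_gen/sym_rel_lin.
Qed.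

Lemma sym_in_comm i j u v : homog V i u -> homog V j v ->
  sym_in u * sym_in v = (-1) ^ (i * j) *: (sym_in v * sym_in u).
Proof.
move=> hu hv; rewrite sym_in.unlock -!sym_piM -sym_piZ.
by apply/sym_pi_eq/sym_ideal_gen; apply: sym_rel_comm hu hv.
Qed.

Lemma sym_scaleAl c (x y : sym_type V) : c *: (x * y) = (c *: x) * y.
Proof.
rewrite -[x]sym_piK -[y]sym_piK -sym_piM -!sym_piZ -sym_piM.
by rewrite scalerAl.
Qed.

Lemma sym_scaleAr c (x y : sym_type V) : c *: (x * y) = x * (c *: y).
Proof.
rewrite -[x]sym_piK -[y]sym_piK -sym_piM -!sym_piZ -sym_piM.
by rewrite malg_scalerAr.
Qed.

Variables (p : nat) (v : 'I_p -> V) (a : 'I_p -> int).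
Hypothesis va : forall i, homog V (a i) (v i).

Local Notation X i := (sym_in (v i)).

Lemma sym_move (P : pred 'I_p) (k : 'I_p) (L : seq 'I_p) :
  (\prod_(i <- L | P i) X i) * X k =
  (\prod_(i <- L | P i) (-1) ^ (a k * a i)) *: (X k * \prod_(i <- L | P i) X i).
Proof.
elim: L => [|x L IH]; first by rewrite !big_nil mul1r mulr1 scale1r.
rewrite !big_cons; case: (P x); last exact: IH.
rewrite -mulrA IH -sym_scaleAr mulrA (sym_in_comm (va x) (va k)).
rewrite -sym_scaleAl scalerA -[X k * _ * _]mulrA; congr (_ *: _).
by rewrite mulrC [a k * _]mulrC.
Qed.

Lemma sym_front (A : {set 'I_p}) (k : 'I_p) : k \notin A ->
  \prod_(i in k |: A) X i =
  (\prod_(i in A | (i < k)%N) (-1) ^ (a k * a i)) *: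
  (X k * \prod_(i in A) X i).
Proof.
move=> kA.
have [L1 [L2 [e h1 h2]]] : exists L1 L2, [/\ enum 'I_p = L1 ++ k :: L2,
    forall i, i \in L1 -> (i < k)%N & forall i, i \in L2 -> (k < i)%N].
  have srt : sorted ltn (map val (enum 'I_p)).
    by rewrite val_enum_ord iota_ltn_sorted.
  have := mem_enum 'I_p k; rewrite inE => /splitPr hk.
  case: hk srt => L1 L2; rewrite map_cat /= => srt.
  exists L1, L2; split => // i hi.
    move: srt; rewrite (sorted_pairwise ltn_trans) pairwise_cat allrel_consr.
    by case/and3P => /andP[/allP h _ _ _]; apply: h; apply: map_f.
  move: srt; rewrite (sorted_pairwise ltn_trans) pairwise_cat /=.
  by case/and4P => _ _ /allP h _; apply: h; apply: map_f.
have eA : enum 'I_p = index_enum 'I_p by rewrite enumT /index_enum unlock.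
rewrite -!eA e !big_cat !big_cons /= !inE eqxx ltnn (negbTE kA) /=.
have E1 (T : Type) (R : T) (op : T -> T -> T) (F : 'I_p -> T) :
    \big[op/R]_(i <- L1 | i \in k |: A) F i =
    \big[op/R]_(i <- L1 | i \in A) F i.
  rewrite [LHS]big_seq_cond [RHS]big_seq_cond; apply: eq_bigl => i.
  case: (boolP (i \in L1)) => //= /h1 hi; rewrite !inE.
  by case: eqP hi => // ->; rewrite ltnn.
have E2 (T : Type) (R : T) (op : T -> T -> T) (F : 'I_p -> T) :
    \big[op/R]_(i <- L2 | i \in k |: A) F i =
    \big[op/R]_(i <- L2 | i \in A) F i.
  rewrite [LHS]big_seq_cond [RHS]big_seq_cond; apply: eq_bigl => i.
  case: (boolP (i \in L2)) => //= /h2 hi; rewrite !inE.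
  by case: eqP hi => // ->; rewrite ltnn.
rewrite E1 E2 mulrA sym_move -sym_scaleAl -mulrA; congr (_ *: _).
have -> : \prod_(i <- L2 | (i \in A) && (i < k)%N) (-1) ^ (a k * a i) = 1 :> K.
  rewrite big_seq_cond big_pred0 // => i.
  by case: (boolP (i \in L2)) => //= /h2 hi; rewrite ltnNge (ltnW hi) andbF.
rewrite mulr1 [LHS]big_seq_cond [RHS]big_seq_cond; apply: eq_bigl => i.
by case: (boolP (i \in L1)) => //= /h1 ->; rewrite andbT.
Qed.

Lemma koszul_inj q (f : 'I_q -> 'I_p) : injective f ->
  \prod_(i in [set f x | x in 'I_q]) X i =
  (\prod_(i < q) \prod_(j < q | (i < j)%N && (f j < f i)%N)
     (-1) ^ (a (f i) * a (f j))) *: \prod_(i < q) X (f i).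
Proof.
elim: q f => [|q IH] f finj.
  rewrite !big_ord0 scale1r big_pred0 // => i.
  by apply/negP => /imsetP[[]].
pose f' i := f (lift ord0 i).
have f'inj : injective f' by move=> i j /finj/lift_inj.
have -> : [set f x | x in 'I_q.+1] = f ord0 |: [set f' x | x in 'I_q].
  apply/setP => i; rewrite !inE; apply/imsetP/orP.
    case=> x _ ->; case: (unliftP ord0 x) => [y|] ->; last by left.
    by right; apply/imsetP; exists y.
  by case=> [/eqP -> | /imsetP[x _ ->]]; eexists.
rewrite sym_front; last first.
  by apply/imsetP => -[x _ /finj /eqP]; rewrite (negbTE (neq_lift _ _)).
rewrite (IH _ f'inj) -sym_scaleAr scalerA.
rewrite [\prod_(i < q.+1) sym_in _]big_ord_recl.
congr (_ *: _); rewrite [RHS]big_ord_recl; congr (_ * _).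
  rewrite big_mkcondr big_imset /=; last by move=> ? ? _ _ /f'inj.
  by rewrite [RHS]big_mkcond big_ord_recl /= mul1r.
apply: eq_bigr => i _; rewrite [LHS]big_mkcond [RHS]big_mkcond.
by rewrite [RHS]big_ord_recl /= mul1r.
Qed.

Lemma koszulE (s : 'S_p) :
  sym_prod [seq v i | i <- enum 'I_p] =
  koszul K s a *: sym_prod [seq v (s i) | i <- enum 'I_p].
Proof.
have E (F : 'I_p -> sym_type V) :
    \prod_(i <- Finite.enum 'I_p) F i = \prod_(i < p) F i.
  by rewrite /index_enum unlock.
rewrite /sym_prod !big_map !E; have <- := koszul_inj (@perm_inj _ s).
apply: eq_bigl => i; apply/esym/imsetP.
by exists (s^-1%g i); rewrite // permKV.
Qed.

End KoszulSign.

(** * The cochain complex *)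

Section Cochains.
Variables (K : fieldType) (g h : sgLa K).

(* C^*(h, g) *)
Definition cochain : gspace K := gHom (Sym h) g.

(* f_k (v_1, ..., v_k), where k is the length of the sequence *)
Definition cev (f : cochain) (s : seq h) : g := gsum_val f (sym_prod s).

Definition tup (p : nat) (v : 'I_p -> h) : seq h := [seq v i | i <- enum 'I_p].

Definition diff_formula (lambda : K) (d : cochain -> cochain) : Prop :=
  forall n f, homog cochain n f ->
  forall p (v : 'I_p -> h) (a : 'I_p -> int), (forall i, homog h (a i) (v i)) ->
  cev (d f) (tup v) =
  \sum_(i < p) \sum_(j < p | (i < j)%N)
    (-1) ^ (n + 1 + a i * (\sum_(k < p | (k < i)%N) a k)
            + a j * (\sum_(k < p | (k < j)%N) a k) + a i * a j)
    *: cev f ((lambda *: [sg (v i), (v j)])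
              :: [seq v k | k <- enum 'I_p & (k != i) && (k != j)]).

Definition is_cochain_diff (lambda : K) (d : cochain -> cochain) : Prop :=
  hom_deg 1 d /\ diff_formula lambda d.

(* w s is (v_s(1), ..., v_s(p)), and l = p + 1 - k throughout. *)
Definition bracket_formula (rho : g -> Der h)
    (B : cochain -> cochain -> cochain) : Prop :=
  forall m n f f', homog cochain m f -> homog cochain n f' ->
  forall p (v : 'I_p -> h) (a : 'I_p -> int), (forall i, homog h (a i) (v i)) ->
  let w (s : 'S_p) := tup (fun i => v (s i)) in
  cev (B f f') (tup v) =
  - (\sum_(1 <= k < p.+2) let l := (p.+1 - k)%N in
      \sum_(s : 'S_p | shuffle [:: l%:Z; 1; p%:Z - l%:Z - 1] s)
        koszul K s a *:
        cev f (der_fun (rho (cev f' (take l (w s)))) (nth 0 (w s) l)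
               :: drop l.+1 (w s)))
  + (-1) ^ ((m + 1) * (n + 1)) *:
    (\sum_(1 <= k < p.+2)
      \sum_(s : 'S_p | shuffle [:: k%:Z - 1; 1; p%:Z - k%:Z] s)
        koszul K s a *:
        cev f' (der_fun (rho (cev f (take k.-1 (w s)))) (nth 0 (w s) k.-1)
                :: drop k (w s)))
  - (\sum_(1 <= k < p.+2) let l := (p.+1 - k)%N in
      \sum_(s : 'S_p | shuffle [:: k%:Z - 1; l%:Z] s)
        ((-1) ^ (n * (\sum_(i < p | (i < k.-1)%N) a (s i)) + m + 1)
         * koszul K s a) *:
        [sg (cev f (take k.-1 (w s))), (cev f' (drop k.-1 (w s)))]).

Definition is_cochain_bracket (rho : g -> Der h)
    (B : cochain -> cochain -> cochain) : Prop :=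
  bilinear_deg 1 B /\ bracket_formula rho B.

End Cochains.

(* Main.v *)
Require Import Defs.
From mathcomp Require Import all_boot all_order all_algebra.
From mathcomp Require Import fingroup perm.
From mathcomp Require Import boolp functions.
From mathcomp Require Import finmap monalg.
From mathcomp Require Import zify.

Set Implicit Arguments.
Unset Strict Implicit.
Unset Printing Implicit Defensive.

Import Order.TTheory GRing.Theory Num.Theory.
Local Open Scope ring_scope.

(** The cochains are functions on h, regarded as a formal graded manifold,
    with values in g, and the three terms of the bracket are those of the action
    Lie algebroid: two derivatives along vector fields and a pointwise bracket.
    To make every sign a Koszul sign, degrees of g are raised by one, so that f
    of degree m counts as M = m + 1, and [x, y] is replaced by
    [x, y]' = (-1)^|x| [x, y] for the raised |x|; this is an ordinary graded Lie
    bracket, and rho becomes a morphism of degree 0 to the graded commutator.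

    An element x of g acts on S(h) by the derivation extending rho(x).  For a
    cochain f put R_f(X) = sum +- rho(f(X')) X'', the sum being over the
    coproduct of S(h), and let f # g be the convolution of f and g through
    [ , ]'.  The opposite of the bracket of the theorem is
      B(f, g) = f R_g - (-1)^(MN) g R_f + f # g,
    and d g = (-1)^N lambda g Q, where Q is the quadratic map of S(h) given by
    the bracket of h.  Since the coproduct is coassociative and cocommutative
    and the action of x is a coderivation, R_f is a coderivation and
    R_f R_g - (-1)^(MN) R_g R_f = R_B(f, g) ([vd_comm]).  Jacobi for B ([wBJ])
    follows from this, the coderivation rule for f # g ([vd_cv]) and Jacobi for
    the convolution bracket ([cvJ]).  Q is a coderivation of square zero
    ([qd_cop2], [qd_qd]) which commutes with the action, because rho(x) is a
    derivation of h ([dr_qd]); so d is a derivation of B of square zero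
    ([wd_wB], [wd_wd]).

    None of this is carried out in S(h).  A linear map on S(h) is the same as a
    multilinear graded symmetric function of words in homogeneous vectors
    ([Sym_ext], [eq_on_wprod]), and precomposition with the operators above is
    defined for functions of words by recursion on the first letter, that is, by
    saying how the derivative in the direction of that letter passes through the
    operator.  Every identity is then an induction on the word in which the
    function varies, the inductive step being an identity of signs.

    The sums over shuffles of the statement are turned into the recursive
    coproduct by following the position at which a permutation takes its least
    value ([blocked_sum]).  Both operations are determined on homogeneous
    cochains, and they are extended to all cochains by linearity. *)

(** * Signs *)

Definition par (n : int) : bool := odd `|n|%N.

Lemma parD m n : par (m + n) = par m (+) par n.
Proof.
rewrite /par; case: m => m; case: n => n; rewrite ?NegzE.
- by rewrite -PoszD !absz_nat oddD.
- case: (leqP n.+1 m) => h.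
  + by rewrite subzn // absz_nat abszN oddB.
  + by rewrite -opprB subzn ?abszN ?(ltnW h) // !absz_nat oddB ?(ltnW h) // addbC.
- rewrite addrC; case: (leqP m.+1 n) => h.
  + by rewrite subzn // absz_nat abszN oddB // addbC.
  + by rewrite -opprB subzn ?abszN ?(ltnW h) // !absz_nat oddB ?(ltnW h) // addbC.
- by rewrite -opprD -PoszD !abszN !absz_nat oddD.
Qed.

Lemma parM m n : par (m * n) = par m && par n.
Proof. by rewrite /par abszM oddM. Qed.

Lemma parN n : par (- n) = par n.
Proof. by rewrite /par abszN. Qed.

Lemma par0 : par 0 = false. Proof. by []. Qed.
Lemma par1 : par 1 = true. Proof. by []. Qed.

Section Sign.
Variable K : fieldType.
Definition sgn (n : int) : K := (-1) ^ n.

Lemma sgnE n : sgn n = (-1) ^+ (par n).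
Proof.
rewrite /sgn /par; case: n => n; first by rewrite -exprnP signr_odd.
by rewrite NegzE abszN absz_nat signr_odd -exprnN -exprVn invrN1.
Qed.

Lemma sgnD m n : sgn (m + n) = sgn m * sgn n.
Proof. by rewrite !sgnE parD signr_addb. Qed.

Lemma sgn0 : sgn 0 = 1. Proof. by rewrite sgnE. Qed.
Lemma sgn1 : sgn 1 = -1. Proof. by rewrite sgnE expr1. Qed.

Lemma eq_sgn m n : par m = par n -> sgn m = sgn n.
Proof. by rewrite !sgnE => ->. Qed.

End Sign.
Arguments sgn {K} n.

(** * Linearity as a predicate on functions *)

Section LinearFacts.
Variables (K : fieldType) (U W : lmodType K) (L : U -> W) (hL : linear L).
Lemma linD x y : L (x + y) = L x + L y.
Proof. by have := hL 1 x y; rewrite !scale1r. Qed.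
Lemma lin0 : L 0 = 0.
Proof. by apply: (addrI (L 0)); rewrite -linD !addr0. Qed.
Lemma linZ c x : L (c *: x) = c *: L x.
Proof. by have := hL c x 0; rewrite lin0 !addr0. Qed.
Lemma linN x : L (- x) = - L x.
Proof. by rewrite -!scaleN1r linZ. Qed.
Lemma linB x y : L (x - y) = L x - L y.
Proof. by rewrite linD linN. Qed.
Lemma lin_sum (I : Type) (r : seq I) (P : pred I) (F : I -> U) :
  L (\sum_(i <- r | P i) F i) = \sum_(i <- r | P i) L (F i).
Proof. by apply: (big_morph L linD lin0). Qed.
End LinearFacts.

(** * Identities in abelian groups up to signs *)

(** Signs are equal when their exponents have the same parity, which is a
    propositional tautology in the parities of the degrees. *)
Ltac sgn_eq := apply: eq_sgn;
  do ?rewrite (parD, parM, parN, par1, par0);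
  repeat match goal with |- context [par ?x] => case: (par x) end; reflexivity.

(** An identity in an abelian group follows from equality of the integer
    coefficients of each atom on both sides; [zmod] reifies both sides and
    compares these coefficients by computation. *)
Inductive zexp := ZVar of nat | ZAdd of zexp & zexp | ZOpp of zexp | ZZero.
Section ZmodSolver.
Variable W : zmodType.
Fixpoint zeval (env : seq W) t : W :=
  match t with
  | ZVar i => nth 0 env i
  | ZAdd a b => zeval env a + zeval env b
  | ZOpp a => - zeval env a
  | ZZero => 0
  end.
Fixpoint zcoef t (i : nat) : int :=
  match t with
  | ZVar j => if i == j then 1 else 0
  | ZAdd a b => zcoef a i + zcoef b i
  | ZOpp a => - zcoef a i
  | ZZero => 0
  end.
Lemma zevalE env t :
  zeval env t = \sum_(i <- iota 0 (size env)) nth 0 env i *~ zcoef t i.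
Proof.
elim: t => [j|a IHa b IHb|a IHa|] /=; rewrite ?IHa ?IHb.
- case: (ltnP j (size env)) => hj.
    rewrite (bigD1_seq j) ?iota_uniq ?mem_iota //= eqxx mulr1z big1 ?addr0 //.
    by move=> i /negbTE ->; rewrite mulr0z.
  rewrite nth_default // big_seq big1 // => i; rewrite mem_iota => /andP[_ hi].
  by rewrite ltn_eqF ?mulr0z // (leq_trans hi).
- by rewrite -big_split; apply: eq_bigr => i _; rewrite mulrzDr.
- by rewrite -sumrN; apply: eq_bigr => i _; rewrite mulrNz.
- by rewrite big1 // => i _; rewrite mulr0z.
Qed.
Lemma zmod_eq env t u :
  all (fun i => zcoef t i == zcoef u i) (iota 0 (size env)) ->
  zeval env t = zeval env u.
Proof.
move=> /allP h; rewrite !zevalE; apply: eq_big_seq => i hi.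
by rewrite (eqP (h i hi)).
Qed.
End ZmodSolver.

(** Occurrences of an atom are identified up to conversion, since rewriting
    produces syntactically different structure arguments. *)
Ltac zindex x env :=
  match env with
  | ?y :: _ => let _ := match goal with _ => unify x y end in constr:(0%N)
  | _ :: ?e => let n := zindex x e in constr:(S n)
  end.
Ltac zatoms t env :=
  lazymatch t with
  | @Algebra.add _ ?a ?b => let e := zatoms a env in zatoms b e
  | @Algebra.opp _ ?a => zatoms a env
  | @Algebra.zero _ => env
  | _ => match env with
         | _ => let n := zindex t env in env
         | _ => constr:(t :: env)
         end
  end.
Ltac zreify t env :=
  lazymatch t with
  | @Algebra.add _ ?a ?b => let u := zreify a env in let v := zreify b env in
      constr:(ZAdd u v)
  | @Algebra.opp _ ?a => let u := zreify a env in constr:(ZOpp u)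
  | @Algebra.zero _ => constr:(ZZero)
  | _ => let n := zindex t env in constr:(ZVar n)
  end.
Ltac zmod :=
  lazymatch goal with
  | |- @eq ?T ?l ?r =>
    let e0 := constr:(@nil T) in
    let e1 := zatoms l e0 in let e := zatoms r e1 in
    let u := zreify l e in let v := zreify r e in
    apply: (@zmod_eq _ e u v); vm_compute; reflexivity
  end.

(** Once every degree has a known parity all signs are 1 or -1, and an identity
    between signed sums becomes one in an abelian group. *)
Ltac sgn_cases :=
  rewrite ?sgnE; do ?rewrite (parD, parM, parN, par1, par0);
  repeat match goal with |- context [par ?x] => case: (par x) end;
  rewrite /= ?expr0 ?expr1 ?scale1r ?scaleN1r.
Ltac sgn_zmod := sgn_cases; zmod.

(** * Functions of words, coproduct and coderivations *)

Section Words.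
Variables (K : fieldType) (E : Type) (deg : E -> int).
Implicit Types (s a b c d : seq E) (v : E) (W : lmodType K).

Definition word_deg s : int := \sum_(v <- s) deg v.
Local Notation wdeg := word_deg.

Lemma wdeg_nil : wdeg [::] = 0. Proof. exact: big_nil. Qed.
Lemma wdeg_cons v s : wdeg (v :: s) = deg v + wdeg s. Proof. exact: big_cons. Qed.
Lemma wdeg_cat a b : wdeg (a ++ b) = wdeg a + wdeg b. Proof. exact: big_cat. Qed.

(** The sum of +- T(s', s'') over all ways of splitting s into two subwords,
    with the Koszul sign; on products of letters it is the coproduct of the
    symmetric algebra. The first letter goes to the left part, or it goes to the
    right part and passes over the left one. *)
Fixpoint coprod2 W (T : seq E -> seq E -> W) s : W :=
  if s is v :: s' then
    coprod2 (fun a b => T (v :: a) b) s'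
    + coprod2 (fun a b => sgn (deg v * wdeg a) *: T a (v :: b)) s'
  else T [::] [::].
Local Notation cop2 := coprod2.

Fixpoint coprod3 W (T : seq E -> seq E -> seq E -> W) s : W :=
  if s is v :: s' then
    coprod3 (fun a b c => T (v :: a) b c) s'
    + coprod3 (fun a b c => sgn (deg v * wdeg a) *: T a (v :: b) c) s'
    + coprod3 (fun a b c => sgn (deg v * (wdeg a + wdeg b)) *: T a b (v :: c)) s'
  else T [::] [::] [::].
Local Notation cop3 := coprod3.

(** Lengths and degrees of the parts add up, so signs in T may be rewritten with
    the degree of the whole word. *)
Lemma eq_cop2 W (T T' : seq E -> seq E -> W) s :
  (forall a b, (wdeg a + wdeg b = wdeg s) -> (size a + size b = size s)%N ->
     T a b = T' a b) ->
  cop2 T s = cop2 T' s.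
Proof.
elim: s T T' => [|v s IH] T T' h /=; first by rewrite h ?addr0 ?wdeg_nil.
congr (_ + _); apply: IH => a b hd hs.
  by apply: h; rewrite ?wdeg_cons -?addrA ?hd //= addSn hs.
by congr (_ *: _); apply: h; rewrite ?wdeg_cons /= ?addnS ?hs // addrCA hd.
Qed.

Lemma eq_cop3 W (T T' : seq E -> seq E -> seq E -> W) s :
  (forall a b c, wdeg a + wdeg b + wdeg c = wdeg s ->
     (size a + size b + size c = size s)%N -> T a b c = T' a b c) ->
  cop3 T s = cop3 T' s.
Proof.
elim: s T T' => [|v s IH] T T' h /=; first by rewrite h ?addr0 ?wdeg_nil.
congr (_ + _ + _); apply: IH => a b c hd hs.
- by apply: h; rewrite ?wdeg_cons -?hd ?addrA // !addSn hs.
- congr (_ *: _); apply: h; rewrite ?wdeg_cons -?hd.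
    by rewrite -!addrA [wdeg a + _]addrCA.
  by rewrite /= addnS addSn hs.
- congr (_ *: _); apply: h; rewrite ?wdeg_cons -?hd; first by rewrite addrCA.
  by rewrite /= addnS hs.
Qed.

Lemma cop2_lin W W' (L : W -> W') (hL : linear L) (T : seq E -> seq E -> W) s :
  cop2 (fun a b => L (T a b)) s = L (cop2 T s).
Proof.
elim: s T => [|v s IH] T //=; rewrite (linD hL) -!IH; congr (_ + _).
by apply: eq_cop2 => a b _ _; rewrite (linZ hL).
Qed.

Lemma cop3_lin W W' (L : W -> W') (hL : linear L) (T : seq E -> seq E -> seq E -> W) s :
  cop3 (fun a b c => L (T a b c)) s = L (cop3 T s).
Proof.
elim: s T => [|v s IH] T //=; rewrite !(linD hL) -!IH; congr (_ + _ + _).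
  by apply: eq_cop3 => a b c _ _; rewrite (linZ hL).
by apply: eq_cop3 => a b c _ _; rewrite (linZ hL).
Qed.

Lemma scale_linear W (k : K) : linear (fun x : W => k *: x).
Proof. by move=> c x y; rewrite scalerDr !scalerA mulrC. Qed.

Lemma cop2Z W (k : K) (T : seq E -> seq E -> W) s :
  cop2 (fun a b => k *: T a b) s = k *: cop2 T s.
Proof. exact: (cop2_lin (@scale_linear W k)). Qed.

Lemma cop3Z W (k : K) (T : seq E -> seq E -> seq E -> W) s :
  cop3 (fun a b c => k *: T a b c) s = k *: cop3 T s.
Proof. exact: (cop3_lin (@scale_linear W k)). Qed.

Lemma cop2D W (T T' : seq E -> seq E -> W) s :
  cop2 (fun a b => T a b + T' a b) s = cop2 T s + cop2 T' s.
Proof.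
elim: s T T' => [|v s IH] T T' //=; rewrite IH addrACA; congr (_ + _).
by rewrite -IH; apply: eq_cop2 => a b _ _; rewrite scalerDr.
Qed.

Lemma cop2N W (T : seq E -> seq E -> W) s :
  cop2 (fun a b => - T a b) s = - cop2 T s.
Proof.
rewrite -scaleN1r -cop2Z; apply: eq_cop2 => a b _ _; by rewrite scaleN1r.
Qed.

Lemma cop3D W (T T' : seq E -> seq E -> seq E -> W) s :
  cop3 (fun a b c => T a b c + T' a b c) s = cop3 T s + cop3 T' s.
Proof.
elim: s T T' => [|v s IH] T T' //=; rewrite IH addrACA; congr (_ + _).
  by rewrite [RHS]addrACA; congr (_ + _); rewrite -IH; apply: eq_cop3 => a b c _ _; rewrite
    scalerDr.
by rewrite -IH; apply: eq_cop3 => a b c _ _; rewrite scalerDr.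
Qed.

(** With [cop3_r], coassociativity. *)
Lemma cop3_l W (T : seq E -> seq E -> seq E -> W) s :
  cop2 (fun a b => cop2 (fun c d => T c d b) a) s = cop3 T s.
Proof.
elim: s T => [|v s IH] T //=; rewrite cop2D; congr (_ + _ + _).
- by rewrite -IH.
- by rewrite -IH.
- rewrite -IH; apply: eq_cop2 => a b _ _; rewrite -cop2Z; apply: eq_cop2 => c d e _.
  by rewrite e.
Qed.

Lemma cop3_r W (T : seq E -> seq E -> seq E -> W) s :
  cop2 (fun a b => cop2 (fun c d => T a c d) b) s = cop3 T s.
Proof.
elim: s T => [|v s IH] T //=; rewrite -!IH -addrA; congr (_ + _).
rewrite -cop2D; apply: eq_cop2 => a b _ _; rewrite scalerDr -!cop2Z; congr (_ + _).
apply: eq_cop2 => c d _ _; rewrite scalerA -sgnD; congr (_ *: _); sgn_eq.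
Qed.

(** Cocommutativity. *)
Lemma cop2C W (T : seq E -> seq E -> W) s :
  cop2 T s = cop2 (fun a b => sgn (wdeg a * wdeg b) *: T b a) s.
Proof.
elim: s T => [|v s IH] T /=; first by rewrite wdeg_nil mul0r sgn0 scale1r.
rewrite addrC; congr (_ + _); rewrite [LHS]IH; apply: eq_cop2 => a b _ _;
  rewrite ?wdeg_cons scalerA -?sgnD; congr (_ *: _); sgn_eq.
Qed.

Lemma cop3C W (T : seq E -> seq E -> seq E -> W) s :
  cop3 T s = cop3 (fun a b c => sgn (wdeg a * wdeg b) *: T b a c) s.
Proof.
rewrite -!cop3_l; apply: eq_cop2 => a b _ _; exact: cop2C.
Qed.

(** phi precomposed with the derivation of degree n of the symmetric algebra
    which is D on letters. *)
Fixpoint letter_deriv (n : int) (D : E -> E) W (phi : seq E -> W) s : W :=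
  if s is v :: s' then
    phi (D v :: s') + sgn (n * deg v) *: letter_deriv n D (fun x => phi (v :: x)) s'
  else 0.
Local Notation dr := letter_deriv.

Lemma eq_dr_in n D W (phi psi : seq E -> W) s :
  (forall v, deg (D v) = deg v + n) ->
  (forall x, wdeg x = wdeg s + n -> phi x = psi x) ->
  dr n D phi s = dr n D psi s.
Proof.
move=> hD; elim: s phi psi => [|v s IH] phi psi h //=.
rewrite h; last by rewrite !wdeg_cons hD addrAC.
congr (_ + _ *: _); apply: IH => x hx.
by apply: h; rewrite !wdeg_cons hx addrA.
Qed.

Lemma eq_dr n D W (phi psi : seq E -> W) s :
  phi =1 psi -> dr n D phi s = dr n D psi s.
Proof. by elim: s phi psi => [|v s IH] phi psi h //=; rewrite h (IH _ (fun x => psi (v::x))). Qed.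

Lemma dr_lin n D W W' (L : W -> W') (hL : linear L) (phi : seq E -> W) s :
  dr n D (fun x => L (phi x)) s = L (dr n D phi s).
Proof.
elim: s phi => [|v s IH] phi /=; first by rewrite (lin0 hL).
by rewrite (linD hL) (linZ hL) -IH.
Qed.

Lemma drZ n D W k (phi : seq E -> W) s :
  dr n D (fun x => k *: phi x) s = k *: dr n D phi s.
Proof. exact: (dr_lin _ _ (@scale_linear W k)). Qed.

Lemma drD n D W (phi psi : seq E -> W) s :
  dr n D (fun x => phi x + psi x) s = dr n D phi s + dr n D psi s.
Proof.
elim: s phi psi => [|v s IH] phi psi /=; first by rewrite addr0.
by rewrite IH scalerDr addrACA.
Qed.

Lemma dr_family_lin (G W : lmodType K) (R : G -> E -> E) (phi : seq E -> W) n s :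
  (forall p e s, linear (fun x => phi (p ++ R x e :: s))) ->
  linear (fun x => dr n (R x) phi s).
Proof.
elim: s phi => [|v s IH] phi h k x y /=; first by rewrite scaler0 addr0.
have {}IH := IH (fun x => phi (v :: x)) (fun p => h (v :: p)).
rewrite IH; have := h [::] v s k x y; rewrite /= => ->.
rewrite !scalerDr !scalerA [sgn _ * k]mulrC; exact: addrACA.
Qed.

(** A derivation of the symmetric algebra which preserves the space of letters
    is also a coderivation. *)
Lemma dr_cop2 n D W (T : seq E -> seq E -> W) s :
  (forall v, deg (D v) = deg v + n) ->
  dr n D (cop2 T) s =
  cop2 (fun a b => dr n D (fun x => T x b) a + sgn (n * wdeg a) *: dr n D (fun x => T a x) b) s.
Proof.
move=> hD; elim: s T => [|v s IH] T /=; first by rewrite scaler0 addr0.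
rewrite drD !IH -!cop2D -!cop2Z -!cop2D; apply: eq_cop2 => a b _ _.
(* D raises the degree of the left part, over which v has to pass, by n. *)
have e : dr n D (fun x => sgn (deg v * wdeg x) *: T x (v :: b)) a =
         sgn (deg v * (wdeg a + n)) *: dr n D (fun x => T x (v :: b)) a.
  by rewrite -drZ; apply: eq_dr_in => // x ->.
rewrite e drZ !scalerDr !wdeg_cons !scalerA -!sgnD hD.
sgn_zmod.
Qed.

Definition gsym W (F : seq E -> W) := forall p u v s,
  F (p ++ u :: v :: s) = sgn (deg u * deg v) *: F (p ++ v :: u :: s).

Lemma gsym_cons W (F : seq E -> W) v : gsym F -> gsym (fun s => F (v :: s)).
Proof. by move=> h p; apply: (h (v :: p)). Qed.

Section Membership.
Variables (W : lmodType K) (S : W -> Prop).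
Hypotheses (S0 : S 0) (SD : forall (c : K) x y, S x -> S y -> S (c *: x + y)).

Lemma mem_add x y : S x -> S y -> S (x + y).
Proof. by move=> hx hy; rewrite -[x]scale1r; apply: SD. Qed.
Lemma mem_scale (c : K) x : S x -> S (c *: x).
Proof. by move=> hx; rewrite -[_ *: _]addr0; apply: SD. Qed.

Lemma cop2_mem (T : seq E -> seq E -> W) s :
  (forall a b, wdeg a + wdeg b = wdeg s -> S (T a b)) -> S (cop2 T s).
Proof.
elim: s T => [|v s IH] T h /=; first by apply: h; rewrite wdeg_nil addr0.
apply: mem_add; apply: IH => a b hd; first by apply: h; rewrite !wdeg_cons -hd addrA.
by apply: mem_scale; apply: h; rewrite !wdeg_cons -hd addrCA.
Qed.

Lemma dr_mem n D (phi : seq E -> W) s :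
  (forall v, deg (D v) = deg v + n) ->
  (forall x, wdeg x = wdeg s + n -> S (phi x)) -> S (dr n D phi s).
Proof.
move=> hD; elim: s phi => [|v s IH] phi h //=.
apply: mem_add; first by apply: h; rewrite !wdeg_cons hD addrAC.
by apply: mem_scale; apply: IH => x hx; apply: h; rewrite !wdeg_cons hx addrA.
Qed.
End Membership.

End Words.

(** * The quadratic coderivation *)

Section Quadratic.
Variables (K : fieldType) (E : Type) (deg : E -> int).
Implicit Types (s a b c d p : seq E) (v w : E) (W : lmodType K).
Notation wdeg := (word_deg deg).
Notation cop2 := (coprod2 deg).
Notation dr := (letter_deriv deg).

(** The graded commutator of two derivations is the derivation given by the
    graded commutator on letters: when D and D' hit different letters the two
    orders cancel. The hypothesis concerns the letters in all contexts, as phi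
    changes in the induction. *)
Lemma dr_comm n n' m (k : K) (D D' C : E -> E) W (phi : seq E -> W) s :
  (forall v, deg (D v) = deg v + n) -> (forall v, deg (D' v) = deg v + n') ->
  m = n + n' ->
  (forall p v s, phi (p ++ D (D' v) :: s) - sgn (n * n') *: phi (p ++ D' (D v) :: s)
     = k *: phi (p ++ C v :: s)) ->
  dr n' D' (dr n D phi) s - sgn (n * n') *: dr n D (dr n' D' phi) s
  = k *: dr m C phi s.
Proof.
move=> hD hD' -> ; elim: s phi => [|v s IH] phi h /=.
  by rewrite !scaler0 subr0.
have {}IH := IH (fun x => phi (v :: x)) (fun p => h (v :: p)).
have h0 := h [::] v s; rewrite /= in h0.
rewrite !drD !drZ hD hD' [RHS]scalerDr -h0 scalerA [k * _]mulrC -scalerA -IH.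
rewrite !scalerDr !scalerN !scalerA -!sgnD; sgn_zmod.
Qed.

Variable br : E -> E -> E.
Hypothesis deg_br : forall v w, deg (br v w) = deg w + (deg v + 1).

(** phi precomposed with Q, the sum of +- br v_i v_j times the other letters
    over i < j. The recursion is Q v = ad(v) + (-1)^|v| v Q, where ad(v) is the
    derivation extending br v. *)
Fixpoint quad_deriv W (phi : seq E -> W) s : W :=
  if s is v :: s' then
    dr (deg v + 1) (br v) phi s' + sgn (deg v) *: quad_deriv (fun x => phi (v :: x)) s'
  else 0.
Local Notation qd := quad_deriv.

Lemma eq_qd W (phi psi : seq E -> W) s :
  (forall x, wdeg x = wdeg s + 1 -> phi x = psi x) -> qd phi s = qd psi s.
Proof.
elim: s phi psi => [|v s IH] phi psi h //=.
congr (_ + _ *: _).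
  by apply: eq_dr_in => // x hx; apply: h; rewrite hx wdeg_cons addrA [deg v + _]addrC.
by apply: IH => x hx; apply: h; rewrite !wdeg_cons hx addrA.
Qed.

Lemma qd_lin W W' (L : W -> W') (hL : linear L) (phi : seq E -> W) s :
  qd (fun x => L (phi x)) s = L (qd phi s).
Proof.
elim: s phi => [|v s IH] phi /=; first by rewrite (lin0 hL).
by rewrite (linD hL) (linZ hL) -IH -(dr_lin _ _ _ hL).
Qed.

Lemma qdZ W k (phi : seq E -> W) s : qd (fun x => k *: phi x) s = k *: qd phi s.
Proof. exact: (qd_lin (@scale_linear K W k)). Qed.

Lemma qdD W (phi psi : seq E -> W) s :
  qd (fun x => phi x + psi x) s = qd phi s + qd psi s.
Proof.
elim: s phi psi => [|v s IH] phi psi /=; first by rewrite addr0.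
by rewrite IH drD scalerDr addrACA.
Qed.

Lemma qd_mem W (S : W -> Prop) (S0 : S 0)
    (SD : forall (c : K) x y, S x -> S y -> S (c *: x + y)) (phi : seq E -> W) s :
  (forall x, wdeg x = wdeg s + 1 -> S (phi x)) -> S (qd phi s).
Proof.
elim: s phi => [|v s IH] phi h //=.
apply: mem_add => //; last apply: mem_scale => //.
  apply: (dr_mem (deg := deg)) => // x hx; apply: h.
  by rewrite hx wdeg_cons addrA [deg v + _]addrC.
by apply: IH => x hx; apply: h; rewrite !wdeg_cons hx addrA.
Qed.

(** Q is a coderivation, because each ad(v) is one. *)
Lemma qd_cop2 W (T : seq E -> seq E -> W) s :
  qd (cop2 T) s =
  cop2 (fun a b => qd (fun x => T x b) a + sgn (wdeg a) *: qd (fun x => T a x) b) s.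
Proof.
elim: s T => [|v s IH] T /=; first by rewrite scaler0 addr0.
rewrite qdD !IH dr_cop2 // -!cop2D -!cop2Z -!cop2D; apply: eq_cop2 => a b _ _.
have e : qd (fun x => sgn (deg v * wdeg x) *: T x (v :: b)) a =
         sgn (deg v * (wdeg a + 1)) *: qd (fun x => T x (v :: b)) a.
  by rewrite -qdZ; apply: eq_qd => // x ->.
rewrite e qdZ !scalerDr !wdeg_cons !scalerA -!sgnD; sgn_zmod.
Qed.

(** A derivation D of br commutes with Q in the graded sense, because the
    commutator of D with ad(v) is ad(D v) up to sign. *)
Lemma dr_qd n (D : E -> E) W (phi : seq E -> W) s :
  (forall v, deg (D v) = deg v + n) ->
  (forall p v w s, phi (p ++ D (br v w) :: s) =
      sgn n *: phi (p ++ br (D v) w :: s)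
      + sgn (n * (deg v + 1)) *: phi (p ++ br v (D w) :: s)) ->
  qd (dr n D phi) s = sgn n *: dr n D (qd phi) s.
Proof.
move=> hD; elim: s phi => [|v s IH] phi h /=; first by rewrite scaler0.
have {}IH := IH (fun x => phi (v :: x)) (fun p => h (v :: p)).
rewrite qdD qdZ IH !drD !drZ hD.
have e : deg v + n + 1 = n + (deg v + 1) by rewrite addrA [n + _]addrC.
have hc p w t : phi (p ++ D (br v w) :: t)
    - sgn (n * (deg v + 1)) *: phi (p ++ br v (D w) :: t)
    = sgn n *: phi (p ++ br (D v) w :: t) by rewrite h addrK.
have /(canRL (subrK _)) -> := dr_comm s hD (deg_br v) e hc.
rewrite !scalerDr !scalerA -!sgnD ; sgn_zmod.
Qed.

(** By Jacobi each ad(v) is a derivation of br, hence commutes with Q up to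
    sign, and the two terms Q ad(v) and ad(v) Q of Q Q v cancel. *)
Lemma qd_qd W (phi : seq E -> W) s :
  (forall p u v w s, phi (p ++ br u (br v w) :: s) =
      sgn (deg u + 1) *: phi (p ++ br (br u v) w :: s)
      + sgn ((deg u + 1) * (deg v + 1)) *: phi (p ++ br v (br u w) :: s)) ->
  qd (qd phi) s = 0.
Proof.
elim: s phi => [|v s IH] phi h //=.
have {}IH := IH (fun x => phi (v :: x)) (fun p => h (v :: p)).
rewrite qdD qdZ IH (@dr_qd _ (br v)) //.
rewrite !scalerDr !scalerA -!sgnD ?scaler0; sgn_zmod.
Qed.

End Quadratic.

(** * The bracket of the action algebroid on functions of words *)

Section Algebroid.
Variables (K : fieldType) (E : Type) (deg : E -> int).
Implicit Types (s a b c d p : seq E) (v w e : E) (W : lmodType K).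
Notation wdeg := (word_deg deg).
Notation cop2 := (coprod2 deg).
Notation cop3 := (coprod3 deg).
Notation dr := (letter_deriv deg).

(** A graded Lie algebra G with degree predicate HG. The bracket carries the
    degree of its left argument as a parameter, since in the application the
    sign by which it differs from the given bracket depends on that degree. *)
Variables (G : lmodType K) (HG : int -> G -> Prop).
Variables (lb : int -> G -> G -> G).
Hypothesis HG0 : forall i, HG i 0.
Hypothesis HGD : forall i (c : K) x y, HG i x -> HG i y -> HG i (c *: x + y).
Hypothesis HGlb : forall i j x y, HG i x -> HG j y -> HG (i + j) (lb i x y).
Hypothesis lb_linr : forall i x, linear (lb i x).
Hypothesis lb_linl : forall i y, linear (lb i ^~ y).
Hypothesis lbC : forall i j x y, HG i x -> HG j y ->
  lb i x y = - (sgn (i * j) *: lb j y x).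
Hypothesis lbJ : forall i j k x y z, HG i x -> HG j y -> HG k z ->
  lb i x (lb j y z) = lb (i + j) (lb i x y) z + sgn (i * j) *: lb j y (lb i x z).

Definition cdeg (M : int) (f : seq E -> G) := forall s, HG (wdeg s + M) (f s).

(** The convolution f # g; the sign comes from moving g, of degree N, past the
    letters given to f. *)
Definition conv_bracket M N (f g : seq E -> G) s : G :=
  cop2 (fun a b => sgn (N * wdeg a) *: lb (wdeg a + M) (f a) (g b)) s.
Local Notation cv := conv_bracket.

(** Cocommutativity and antisymmetry of the bracket. *)
Lemma cvC M N f g s : cdeg M f -> cdeg N g ->
  cv M N f g s = - (sgn (M * N) *: cv N M g f s).
Proof.
move=> hf hg; rewrite /conv_bracket cop2C -cop2Z -cop2N; apply: eq_cop2 => a b _ _.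
rewrite (lbC (hf b) (hg a)) scalerN !scalerA -!sgnD; sgn_zmod.
Qed.

(** By coassociativity each term is a sum over splittings into three parts;
    after an exchange of two parts in the last one, Jacobi applies to each
    summand. *)
Lemma cvJ M N P f g k s : cdeg M f -> cdeg N g -> cdeg P k ->
  cv M (N + P) f (cv N P g k) s =
  cv (M + N) P (cv M N f g) k s + sgn (M * N) *: cv N (M + P) g (cv M P f k) s.
Proof.
move=> hf hg hk; rewrite /conv_bracket.
transitivity (cop3 (fun a b c => sgn ((N + P) * wdeg a + P * wdeg b) *:
   lb (wdeg a + M) (f a) (lb (wdeg b + N) (g b) (k c))) s).
  rewrite -cop3_r; apply: eq_cop2 => a b _ _; rewrite -cop2_lin // -cop2Z.
  by apply: eq_cop2 => c d _ _; rewrite (linZ (@lb_linr _ _)) scalerA -sgnD.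
have -> : cop2 (fun a b => sgn (P * wdeg a) *: lb (wdeg a + (M + N))
     (cop2 (fun c d => sgn (N * wdeg c) *: lb (wdeg c + M) (f c) (g d)) a) (k b)) s =
  cop3 (fun a b c => sgn (P * (wdeg a + wdeg b) + N * wdeg a) *:
    lb ((wdeg a + M) + (wdeg b + N)) (lb (wdeg a + M) (f a) (g b)) (k c)) s.
  rewrite -cop3_l; apply: eq_cop2 => a b _ _.
  rewrite -(cop2_lin _ (lb_linl _ _)) -cop2Z.
  apply: eq_cop2 => c d <- _; rewrite (linZ (lb_linl _ _)) scalerA -sgnD.
  by rewrite [wdeg c + M + _]addrACA.
have -> : cop2 (fun a b => sgn ((M + P) * wdeg a) *: lb (wdeg a + N) (g a)
    (cop2 (fun c d => sgn (P * wdeg c) *: lb (wdeg c + M) (f c) (k d)) b)) s =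
  cop3 (fun b a c => sgn ((M + P) * wdeg b + P * wdeg a) *:
    lb (wdeg b + N) (g b) (lb (wdeg a + M) (f a) (k c))) s.
  rewrite -cop3_r; apply: eq_cop2 => a b _ _; rewrite -cop2_lin // -cop2Z.
  by apply: eq_cop2 => c d _ _; rewrite (linZ (@lb_linr _ _)) scalerA -sgnD.
rewrite [X in _ *: X]cop3C -cop3Z -cop3D; apply: eq_cop3 => a b c _ _.
rewrite (lbJ (hf a) (hg b) (hk c)) scalerDr !scalerA -!sgnD; sgn_zmod.
Qed.

(** r i x is the action on letters of an element x of degree i. *)
Variable r : int -> G -> E -> E.
Hypothesis deg_r : forall i x e, deg (r i x e) = deg e + i.

(** What is used of multilinearity of phi: it is applied to the letters r i x
    e. *)
Definition ops_linear W (phi : seq E -> W) :=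
  forall p i e s, linear (fun x => phi (p ++ r i x e :: s)).

Lemma dr_ops_linear W (phi : seq E -> W) n i s : ops_linear phi ->
  linear (fun x => dr n (r i x) phi s).
Proof. by move=> h; apply: dr_family_lin => p e t; apply: h. Qed.

(** phi R_g, for g of degree N. *)
Definition vect_deriv N (g : seq E -> G) W (phi : seq E -> W) s : W :=
  cop2 (fun a b => dr (wdeg a + N) (r (wdeg a + N) (g a)) phi b) s.
Local Notation vd := vect_deriv.

Lemma vd_lin N g W W' (L : W -> W') (hL : linear L) (phi : seq E -> W) s :
  vd N g (fun x => L (phi x)) s = L (vd N g phi s).
Proof.
rewrite /vect_deriv -cop2_lin //; apply: eq_cop2 => a b _ _; exact: dr_lin.
Qed.

Lemma eq_vd N (g g' : seq E -> G) W (phi phi' : seq E -> W) s :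
  g =1 g' -> phi =1 phi' -> vd N g phi s = vd N g' phi' s.
Proof.
move=> e e'; apply: eq_cop2 => a b _ _; rewrite e; exact: eq_dr.
Qed.

Lemma vdD N g W (phi psi : seq E -> W) s :
  vd N g (fun x => phi x + psi x) s = vd N g phi s + vd N g psi s.
Proof. by rewrite /vect_deriv -cop2D; apply: eq_cop2 => a b _ _; rewrite drD. Qed.

Lemma vdZ N g W k (phi : seq E -> W) s :
  vd N g (fun x => k *: phi x) s = k *: vd N g phi s.
Proof. exact: (vd_lin _ _ (@scale_linear K W k)). Qed.

Lemma vd_linl N (g g' : seq E -> G) k W (phi : seq E -> W) s : ops_linear phi ->
  vd N (fun x => k *: g x + g' x) phi s = k *: vd N g phi s + vd N g' phi s.
Proof.
move=> h; rewrite /vect_deriv -cop2Z -cop2D; apply: eq_cop2 => a b _ _.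
exact: (dr_ops_linear (wdeg a + N) (wdeg a + N) b h).
Qed.

(** R_f R_g(X) has the terms in which rho(g(X')) acts inside the argument of f,
    which make up R_h for h = f R_g, and those in which it acts on the remaining
    letters, followed by rho of a value of f. *)
Lemma vd_vd M N f g W (phi : seq E -> W) s : ops_linear phi ->
  vd N g (vd M f phi) s = vd (M + N) (vd N g f) phi s
  + cop3 (fun c a d => sgn (N * wdeg c) *:
       dr (wdeg a + N) (r (wdeg a + N) (g a))
          (dr (wdeg c + M) (r (wdeg c + M) (f c)) phi) d) s.
Proof.
move=> hphi.
have -> : vd (M + N) (vd N g f) phi s =
  cop3 (fun a c d => dr (wdeg a + N + (wdeg c + M)) (r (wdeg a + N + (wdeg c + M))
     (dr (wdeg a + N) (r (wdeg a + N) (g a)) f c)) phi d) s.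
  rewrite -cop3_l; apply: eq_cop2 => x d _ _; rewrite /vect_deriv.
  rewrite -(cop2_lin _ (dr_ops_linear _ _ _ hphi)); apply: eq_cop2 => a c <- _.
  by rewrite [wdeg a + N + _]addrACA [N + M]addrC.
rewrite [X in _ + X]cop3C -cop3D -cop3_r; apply: eq_cop2 => a b _ _.
rewrite /vect_deriv dr_cop2 //; apply: eq_cop2 => c d _ _; congr (_ + _); last first.
  rewrite scalerA -!sgnD; congr (_ *: _); sgn_eq.
rewrite -(dr_lin _ _ _ (dr_ops_linear _ _ _ hphi)); apply: eq_dr_in => // x ->.
by have -> : wdeg c + (wdeg a + N) + M = wdeg a + N + (wdeg c + M) by zmod.
Qed.

(** x -> r i x respects brackets, as seen by phi. *)
Definition ops_comm W (phi : seq E -> W) := forall i j x y, HG i x -> HG j y ->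
  forall p e s, phi (p ++ r i x (r j y e) :: s)
     - sgn (i * j) *: phi (p ++ r j y (r i x e) :: s)
     = phi (p ++ r (i + j) (lb i x y) e :: s).

(** B(f, g) for f, g of degrees M, N. *)
Definition word_bracket M N (f g : seq E -> G) s : G :=
  vd N g f s - sgn (M * N) *: vd M f g s + cv M N f g s.
Local Notation wB := word_bracket.

(** In the commutator the second-order terms of [vd_vd] add up to sums of graded
    commutators of rho(f(a)) and rho(g(b)), which are rho of the convolution. *)
Lemma vd_comm M N f g W (phi : seq E -> W) s :
  ops_linear phi -> ops_comm phi -> cdeg M f -> cdeg N g ->
  vd N g (vd M f phi) s - sgn (M * N) *: vd M f (vd N g phi) s =
  vd (M + N) (wB M N f g) phi s.
Proof.
move=> hl hc hf hg.
have E1 : vd (M + N) (wB M N f g) phi s =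
  vd (M + N) (vd N g f) phi s - sgn (M * N) *: vd (M + N) (vd M f g) phi s
  + vd (M + N) (cv M N f g) phi s.
  rewrite -scaleNr [LHS](@eq_vd _ _ (fun x => 1 *: (- sgn (M * N) *: vd M f g x
    + vd N g f x) + cv M N f g x) _ _ phi) //; last first.
    by move=> x; rewrite /word_bracket scale1r scaleNr; congr (_ + _); rewrite addrC.
  by rewrite vd_linl // scale1r vd_linl //; congr (_ + _); rewrite addrC.
rewrite E1 !vd_vd // [N + M]addrC scalerDr.
have -> : vd (M + N) (cv M N f g) phi s = cop3 (fun a b c => sgn (N * wdeg a) *:
   dr (wdeg a + M + (wdeg b + N))
     (r (wdeg a + M + (wdeg b + N)) (lb (wdeg a + M) (f a) (g b))) phi c) s.
  rewrite -cop3_l; apply: eq_cop2 => x d _ _; rewrite /conv_bracket.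
  rewrite -(cop2_lin _ (dr_ops_linear _ _ _ hl)); apply: eq_cop2 => a c <- _.
  by rewrite [wdeg a + M + _]addrACA (linZ (dr_ops_linear _ _ _ hl)).
set A := vd _ _ phi s; set B := vd _ _ phi s.
rewrite [X in sgn _ *: B + sgn _ *: X]cop3C.
set X := cop3 _ _; set Y := cop3 _ _; set Z := cop3 _ _.
suff -> : Z = X - sgn (M * N) *: Y by zmod.
rewrite /X /Y /Z -scaleNr -cop3Z -cop3D; apply: eq_cop3 => a b c _ _.
have hk p v t : phi (p ++ r (wdeg a + M) (f a) (r (wdeg b + N) (g b) v) :: t)
   - sgn ((wdeg a + M) * (wdeg b + N)) *:
      phi (p ++ r (wdeg b + N) (g b) (r (wdeg a + M) (f a) v) :: t)
   = 1 *: phi (p ++ r (wdeg a + M + (wdeg b + N)) (lb (wdeg a + M) (f a) (g b)) v :: t).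
  by rewrite scale1r (hc _ _ _ _ (hf a) (hg b)).
have := dr_comm c (deg_r (wdeg a + M) (f a)) (deg_r (wdeg b + N) (g b)) erefl hk.
rewrite scale1r => <-.
rewrite scalerBr scaleNr !scalerA -!sgnD; sgn_zmod.
Qed.

(** R_k is a coderivation: rho(k(X')) acts on either factor of the coproduct of
    X'', and cocommutativity brings X' next to the factor on which it acts. *)
Lemma vd_cv M N P f g k s :
  vd P k (cv M N f g) s =
  cv M (N + P) f (vd P k g) s + sgn (P * N) *: cv (M + P) N (vd P k f) g s.
Proof.
have -> : cv M (N + P) f (vd P k g) s =
  cop3 (fun a x b => sgn ((N + P) * wdeg a) *: lb (wdeg a + M) (f a)
     (dr (wdeg x + P) (r (wdeg x + P) (k x)) g b)) s.
  rewrite -cop3_r; apply: eq_cop2 => a b _ _; rewrite /vect_deriv.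
  by rewrite -(cop2_lin _ (@lb_linr _ _)) -cop2Z.
have -> : cv (M + P) N (vd P k f) g s =
  cop3 (fun x a b => sgn (N * (wdeg x + wdeg a)) *: lb (wdeg a + (wdeg x + P) + M)
     (dr (wdeg x + P) (r (wdeg x + P) (k x)) f a) (g b)) s.
  rewrite -cop3_l; apply: eq_cop2 => a b _ _; rewrite /vect_deriv.
  rewrite -(cop2_lin _ (lb_linl _ _)) -cop2Z; apply: eq_cop2 => c d <- _.
  by congr (_ *: lb _ _ _); zmod.
rewrite cop3C -cop3Z -cop3D -cop3_r; apply: eq_cop2 => x y _ _.
rewrite {1}/conv_bracket dr_cop2 //; apply: eq_cop2 => a b _ _; rewrite addrC; congr (_ + _).
  rewrite drZ (dr_lin _ _ _ (@lb_linr _ _)) !scalerA -!sgnD; congr (_ *: _).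
  sgn_eq.
set i := wdeg x + P.
rewrite -(dr_lin _ _ _ (lb_linl _ _)) scalerA -sgnD -drZ.
apply: eq_dr_in => // z ->; congr (_ *: _); first by rewrite /i; sgn_eq.
Qed.

Variable br : E -> E -> E.
Hypothesis deg_br : forall v w, deg (br v w) = deg w + (deg v + 1).
Notation qd := (quad_deriv deg br).

Lemma qd_cv M N f g s :
  qd (cv M N f g) s =
  cv M (N + 1) f (qd g) s + sgn N *: cv (M + 1) N (qd f) g s.
Proof.
rewrite /conv_bracket qd_cop2 // -cop2Z -cop2D; apply: eq_cop2 => a b _ _.
rewrite addrC; congr (_ + _).
  rewrite qdZ // (qd_lin _ _ (@lb_linr _ _)) !scalerA -!sgnD; congr (_ *: _).
  sgn_eq.
rewrite -(qd_lin _ _ (lb_linl _ _)) scalerA -sgnD -qdZ.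
apply: eq_qd => // z ->; rewrite -!addrA [1 + M]addrC; congr (_ *: _); sgn_eq.
Qed.

(** Each r i x is a derivation of br, as seen by phi. *)
Definition ops_der W (phi : seq E -> W) := forall i x, HG i x -> forall p v w s,
  phi (p ++ r i x (br v w) :: s) =
      sgn i *: phi (p ++ br (r i x v) w :: s)
      + sgn (i * (deg v + 1)) *: phi (p ++ br v (r i x w) :: s).

(** Q either meets the argument of g or passes to the letters on which
    rho(g(X')) acts, and there it commutes with the action. *)
Lemma qd_vd N g W (phi : seq E -> W) s :
  ops_linear phi -> ops_der phi -> cdeg N g ->
  qd (vd N g phi) s =
  vd (N + 1) (qd g) phi s + sgn N *: vd N g (qd phi) s.
Proof.
move=> hl hd hg.
rewrite /vect_deriv qd_cop2 // -cop2Z -cop2D; apply: eq_cop2 => a b _ _; congr (_ + _).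
  rewrite -(qd_lin _ _ (dr_ops_linear _ _ _ hl)); apply: eq_qd => // z ->.
  by rewrite -!addrA [1 + N]addrC.
rewrite (dr_qd deg_br _ (deg_r _ _)); last exact: (hd _ _ (hg a)).
rewrite scalerA -sgnD; congr (_ *: _); sgn_eq.
Qed.

Lemma cdeg_cv M N f g : cdeg M f -> cdeg N g -> cdeg (M + N) (cv M N f g).
Proof.
move=> hf hg s; apply: (cop2_mem (HG0 _) (@HGD _)).
move=> a b <-; apply: (mem_scale (HG0 _) (@HGD _)).
by rewrite addrACA; apply: HGlb.
Qed.

Lemma cdeg_vd M N f g : cdeg M f -> cdeg (M + N) (vd N g f).
Proof.
move=> hf s; apply: (cop2_mem (HG0 _) (@HGD _)).
move=> a b hd; apply: (dr_mem (HG0 _) (@HGD _)) => //.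
move=> x hx; have -> : wdeg s + (M + N) = wdeg x + M by rewrite hx -hd; zmod.
exact: hf.
Qed.

Lemma cdeg_wB M N f g : cdeg M f -> cdeg N g -> cdeg (M + N) (wB M N f g).
Proof.
move=> hf hg s; apply: (mem_add (@HGD _)); last exact: cdeg_cv.
rewrite [X in HG _ X]addrC -scaleNr; apply: HGD; last exact: cdeg_vd.
by rewrite (_ : M + N = N + M); [apply: cdeg_vd | exact: addrC].
Qed.

Lemma cdeg_qd M f : cdeg M f -> cdeg (M + 1) (qd f).
Proof.
move=> hf s; apply: (qd_mem deg_br (HG0 _) (@HGD _)).
by move=> x hx; rewrite addrA addrAC -hx.
Qed.

Lemma cv_linr M N f k g g' s :
  cv M N f (fun x => k *: g x + g' x) s = k *: cv M N f g s + cv M N f g' s.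
Proof.
rewrite /conv_bracket -cop2Z -cop2D; apply: eq_cop2 => a b _ _.
by rewrite lb_linr scalerDr !scalerA mulrC.
Qed.

Lemma cv_linl M N g k f f' s :
  cv M N (fun x => k *: f x + f' x) g s = k *: cv M N f g s + cv M N f' g s.
Proof.
rewrite /conv_bracket -cop2Z -cop2D; apply: eq_cop2 => a b _ _.
by rewrite lb_linl scalerDr !scalerA mulrC.
Qed.

Lemma eq_cv M N f f' g g' s : f =1 f' -> g =1 g' -> cv M N f g s = cv M N f' g' s.
Proof. by move=> e e'; apply: eq_cop2 => a b _ _; rewrite e e'. Qed.

(** The shape k f + f' in which the linearity lemmas can be applied. *)
Lemma wB_expand M N f g x :
  wB M N f g x = 1 *: (- sgn (M * N) *: vd M f g x + vd N g f x) + cv M N f g x.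
Proof. by rewrite /word_bracket scale1r scaleNr [- _ + _]addrC. Qed.

Lemma wBE M N f g s : wB M N f g s =
  vd N g f s - sgn (M * N) *: vd M f g s + cv M N f g s.
Proof. by []. Qed.

Lemma cv_wBr L Q M N f g k s :
  cv L Q k (wB M N f g) s =
  cv L Q k (vd N g f) s - sgn (M * N) *: cv L Q k (vd M f g) s
  + cv L Q k (cv M N f g) s.
Proof.
rewrite (eq_cv _ _ _ (fun=> erefl) (wB_expand M N f g)).
by rewrite cv_linr scale1r cv_linr scaleNr [- _ + _]addrC.
Qed.

Lemma cv_wBl L Q M N f g k s :
  cv L Q (wB M N f g) k s =
  cv L Q (vd N g f) k s - sgn (M * N) *: cv L Q (vd M f g) k s
  + cv L Q (cv M N f g) k s.
Proof.
rewrite (eq_cv _ _ _ (wB_expand M N f g) (fun=> erefl)).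
by rewrite cv_linl scale1r cv_linl scaleNr [- _ + _]addrC.
Qed.

Lemma vd_wB M N P f g k s :
  vd P k (wB M N f g) s =
  vd P k (vd N g f) s - sgn (M * N) *: vd P k (vd M f g) s
  + (cv M (N + P) f (vd P k g) s + sgn (P * N) *: cv (M + P) N (vd P k f) g s).
Proof.
rewrite -vd_cv (eq_vd _ _ (fun=> erefl) (wB_expand M N f g)).
by rewrite vdD vdZ scale1r vdD vdZ scaleNr [- _ + _]addrC.
Qed.

Section Identities.
Variables (M N P : int) (f g k : seq E -> G).
Hypotheses (hf : cdeg M f) (hg : cdeg N g) (hk : cdeg P k).

Lemma wBC s : wB M N f g s = - (sgn (M * N) *: wB N M g f s).
Proof.
rewrite /word_bracket (cvC s hf hg) !scalerDr !scalerN !scalerA -!sgnD [N * M]mulrC.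
sgn_zmod.
Qed.

Hypotheses (lf : ops_linear f) (lg : ops_linear g) (lk : ops_linear k).
Hypotheses (cf : ops_comm f) (cg : ops_comm g) (ck : ops_comm k).

(** f R_B(g, k) is a commutator by [vd_comm], and R_k acts on f # g by Leibniz;
    when everything is expanded, the six double derivatives cancel, the
    convolutions with one derivative cancel, and the double convolutions are
    [cvJ]. *)
Lemma wBJ s :
  wB M (N + P) f (wB N P g k) s =
  wB (M + N) P (wB M N f g) k s + sgn (M * N) *: wB N (M + P) g (wB M P f k) s.
Proof.
have kf : cdeg (M + P) (vd P k f) by apply: cdeg_vd.
rewrite !wBE -(vd_comm s lf cf hg hk) -(vd_comm s lk ck hf hg).
rewrite -(vd_comm s lg cg hf hk) !vd_wB !cv_wBr cv_wBl.
(* (f R_k) # g and g # (f R_k) both occur; they are exchanged by [cvC]. *)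
rewrite (cvJ s hf hg hk) (cvC s kf hg) [N + M]addrC [P + M]addrC [P + N]addrC.
rewrite !(scalerDr, scalerN, scalerA) -!sgnD.
sgn_zmod.
Qed.

Lemma qd_wB s : ops_der f -> ops_der g ->
  qd (wB M N f g) s =
  sgn N *: wB (M + 1) N (qd f) g s + wB M (N + 1) f (qd g) s.
Proof.
move=> df dg; rewrite (@eq_qd _ _ _ _ deg_br _ _ _ s (fun x _ => wB_expand M N f g x)).
rewrite !(qdD, qdZ) // !qd_vd // qd_cv !wBE scale1r.
rewrite !(scalerDr, scalerN, scalerA, mulNr, scaleNr) -!sgnD; sgn_zmod.
Qed.

End Identities.

(** The differential of f of degree M; its sign makes it a derivation acting
    from the left. *)
Definition word_diff (lam : K) M (f : seq E -> G) s : G := (sgn M * lam) *: qd f s.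
Local Notation wd := word_diff.

Lemma vd_Zl N g k W (phi : seq E -> W) s : ops_linear phi ->
  vd N (fun x => k *: g x) phi s = k *: vd N g phi s.
Proof.
move=> h; rewrite /vect_deriv -cop2Z; apply: eq_cop2 => a b _ _.
exact: (linZ (dr_ops_linear (wdeg a + N) (wdeg a + N) b h)).
Qed.

Lemma cv_Zl M N f g k s : cv M N (fun x => k *: f x) g s = k *: cv M N f g s.
Proof.
rewrite /conv_bracket -cop2Z; apply: eq_cop2 => a b _ _.
by rewrite (linZ (lb_linl _ _)) !scalerA mulrC.
Qed.

Lemma cv_Zr M N f g k s : cv M N f (fun x => k *: g x) s = k *: cv M N f g s.
Proof.
rewrite /conv_bracket -cop2Z; apply: eq_cop2 => a b _ _.
by rewrite (linZ (@lb_linr _ _)) !scalerA mulrC.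
Qed.

Lemma wB_Zl M N f g k s : ops_linear g ->
  wB M N (fun x => k *: f x) g s = k *: wB M N f g s.
Proof.
move=> hg; rewrite !wBE vdZ vd_Zl // cv_Zl !scalerDr scalerN !scalerA.
by rewrite [k * sgn _]mulrC.
Qed.

Lemma wB_Zr M N f g k s : ops_linear f ->
  wB M N f (fun x => k *: g x) s = k *: wB M N f g s.
Proof.
move=> hf; rewrite !wBE vdZ vd_Zl // cv_Zr !scalerDr scalerN !scalerA.
by rewrite [k * sgn _]mulrC.
Qed.

Lemma wB_linl M N f f' g k s : ops_linear g ->
  wB M N (fun x => k *: f x + f' x) g s = k *: wB M N f g s + wB M N f' g s.
Proof.
move=> hg; rewrite !wBE vdD vdZ vd_linl // cv_linl !scalerDr scalerN !scalerA.
rewrite [k * sgn _]mulrC; zmod.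
Qed.

Lemma wB_linr M N f g g' k s : ops_linear f ->
  wB M N f (fun x => k *: g x + g' x) s = k *: wB M N f g s + wB M N f g' s.
Proof.
move=> hf; rewrite !wBE vdD vdZ vd_linl // cv_linr !scalerDr scalerN !scalerA.
rewrite [k * sgn _]mulrC; zmod.
Qed.

Lemma eq_wB M N f f' g g' s : f =1 f' -> g =1 g' -> wB M N f g s = wB M N f' g' s.
Proof. by move=> e e'; rewrite !wBE (eq_vd _ _ e' e) (eq_vd _ _ e e') (eq_cv _ _ _ e e'). Qed.

Lemma eq_wd lam M f f' s : f =1 f' -> wd lam M f s = wd lam M f' s.
Proof. by move=> e; rewrite /word_diff (eq_qd deg_br (fun x _ => e x)). Qed.

Lemma wd_wB lam M N f g s : cdeg M f -> cdeg N g -> ops_linear f -> ops_linear g ->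
  ops_der f -> ops_der g ->
  wd lam (M + N) (wB M N f g) s =
  wB (M + 1) N (wd lam M f) g s + sgn M *: wB M (N + 1) f (wd lam N g) s.
Proof.
move=> hf hg lf lg df dg; rewrite wB_Zl // wB_Zr // /word_diff qd_wB // scalerDr !scalerA.
congr (_ *: _ + _ *: _); last by rewrite sgnD mulrA.
by rewrite mulrAC -sgnD; congr (_ * _); sgn_eq.
Qed.

Lemma wd_wd lam M f s :
  (forall p u v w s, f (p ++ br u (br v w) :: s) =
      sgn (deg u + 1) *: f (p ++ br (br u v) w :: s)
      + sgn ((deg u + 1) * (deg v + 1)) *: f (p ++ br v (br u w) :: s)) ->
  wd lam (M + 1) (wd lam M f) s = 0.
Proof. by move=> h; rewrite /word_diff qdZ qd_qd // !scaler0. Qed.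

End Algebroid.

(** * Linear extension from homogeneous elements *)

Section GradedExtension.
Variables (K : fieldType) (V : gspace K) (gV : graded V).
Implicit Types (q : int * V) (W : lmodType K).

Lemma homog0 n : homog V n 0. Proof. by case: gV. Qed.
Lemma homog_lin n (c : K) (x y : V) :
  homog V n x -> homog V n y -> homog V n (c *: x + y).
Proof. by case: gV => _ h _ _; apply: h. Qed.
Lemma homogZ n (c : K) (x : V) : homog V n x -> homog V n (c *: x).
Proof. by move=> h; rewrite -[_ *: _]addr0; apply: homog_lin => //; apply: homog0. Qed.
Lemma homogD n (x y : V) : homog V n x -> homog V n y -> homog V n (x + y).
Proof. by move=> h h'; rewrite -[x]scale1r; apply: homog_lin. Qed.
Lemma homog_sum n (I : eqType) (r : seq I) (P : pred I) (F : I -> V) :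
  (forall i, i \in r -> P i -> homog V n (F i)) ->
  homog V n (\sum_(i <- r | P i) F i).
Proof.
move=> h; rewrite big_seq_cond.
apply: big_ind => [|x y|i /andP[]]; [exact: homog0|exact: homogD|exact: h].
Qed.

Lemma decomposition (x : V) : exists s : seq (int * V),
  (forall q, q \in s -> homog V q.1 q.2) /\ x = \sum_(q <- s) q.2.
Proof.
case: gV => _ _ /(_ x) + _; elim=> [|n c y z hy _ [s [hs ->]]].
  by exists [::]; rewrite big_nil.
exists ((n, c *: y) :: s); rewrite big_cons; split=> // q.
by rewrite inE => /predU1P[->|/hs//]; apply: homogZ.
Qed.

(** A chosen decomposition into homogeneous elements, with labels for their
    degrees. *)
Definition homog_dec (x : V) : seq (int * V) := projT1 (cid (decomposition x)).
Lemma homog_dec_homog x q : q \in homog_dec x -> homog V q.1 q.2.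
Proof. by rewrite /homog_dec; case: cid => s [h _] /h. Qed.
Lemma homog_decE x : x = \sum_(q <- homog_dec x) q.2.
Proof. by rewrite /homog_dec; case: cid => s []. Qed.

Definition homog_linear W (H : int * V -> W) := forall n (c : K) x y,
  homog V n x -> homog V n y -> H (n, c *: x + y) = c *: H (n, x) + H (n, y).

(** The linear map with values H (n, x) on homogeneous x of degree n; that it is
    linear, and does not depend on the decomposition, holds for [homog_linear]
    H. *)
Definition graded_ext W (H : int * V -> W) (x : V) : W := \sum_(q <- homog_dec x) H q.

Section Extension.
Variables (W : lmodType K) (H : int * V -> W) (hH : homog_linear H).

Lemma hlin0 n : H (n, 0) = 0.
Proof.
have := hH 1 (homog0 n) (homog0 n); rewrite !scale1r addr0.
by move/eqP; rewrite -[X in X == _]addr0 (inj_eq (addrI _)) eq_sym => /eqP.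
Qed.

Lemma hlin_sum n (I : eqType) (r : seq I) (P : pred I) (F : I -> V) :
  (forall i, i \in r -> P i -> homog V n (F i)) ->
  H (n, \sum_(i <- r | P i) F i) = \sum_(i <- r | P i) H (n, F i).
Proof.
elim: r => [|i r IH] h; first by rewrite !big_nil hlin0.
have h' j : j \in r -> P j -> homog V n (F j).
  by move=> jr; apply: h; rewrite inE jr orbT.
rewrite !big_cons; case: ifP => // Pi; last exact: IH.
have Fi : homog V n (F i) by apply: h; rewrite ?mem_head.
rewrite -[F i]scale1r hH //; first by rewrite IH ?scale1r.
exact: homog_sum.
Qed.

Lemma sum_by_degree (U : lmodType K) (s : seq (int * V)) (F : int * V -> U) :
  \sum_(q <- s) F q =
  \sum_(n <- undup (unzip1 s)) \sum_(q <- s | q.1 == n) F q.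
Proof.
rewrite (exchange_big_dep xpredT) //= big_seq [RHS]big_seq.
apply: eq_bigr => q qs; rewrite (big_rem q.1) /= ?mem_undup ?map_f // eqxx.
rewrite big_seq_cond big_pred0 ?addr0 // => n.
by rewrite mem_rem_uniq ?undup_uniq // !inE eq_sym; case: eqP; rewrite ?andbF.
Qed.

(** Components of the same degree add up to 0, because the sum of the subspaces
    is direct. *)
Lemma sum_eq0 (s : seq (int * V)) : (forall q, q \in s -> homog V q.1 q.2) ->
  \sum_(q <- s) q.2 = 0 -> \sum_(q <- s) H q = 0.
Proof.
move=> hs s0.
pose x n := \sum_(q <- s | q.1 == n) q.2.
have hx n : homog V n (x n).
  by apply: homog_sum => q qs /eqP <-; apply: hs.
have x0 n : n \in undup (unzip1 s) -> x n = 0.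
  case: gV => _ _ _ /(_ (undup (unzip1 s)) x); apply; rewrite ?undup_uniq //.
  by rewrite -[RHS]s0 [RHS]sum_by_degree.
rewrite sum_by_degree big_seq big1 // => n /x0 e.
transitivity (H (n, x n)); last by rewrite e hlin0.
rewrite hlin_sum; last by move=> q qs /eqP <-; apply: hs.
by apply: eq_bigr => -[m y] /= /eqP ->.
Qed.

Lemma graded_extE (s : seq (int * V)) : (forall q, q \in s -> homog V q.1 q.2) ->
  graded_ext H (\sum_(q <- s) q.2) = \sum_(q <- s) H q.
Proof.
move=> hs; set x := \sum_(q <- s) _.
pose t := homog_dec x ++ [seq (q.1, - q.2) | q <- s].
have ht q : q \in t -> homog V q.1 q.2.
  rewrite mem_cat => /orP[/homog_dec_homog//|/mapP[r /hs + ->] /=].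
  by rewrite -scaleN1r; apply: homogZ.
have HN q : homog V q.1 q.2 -> H (q.1, - q.2) = - H q.
  case: q => n y /= hy; have := hH (-1) hy (homog0 n).
  by rewrite hlin0 !addr0 !scaleN1r.
have /(sum_eq0 ht) : \sum_(q <- t) q.2 = 0.
  by rewrite big_cat big_map /= sumrN -homog_decE subrr.
rewrite big_cat big_map /= => /eqP; rewrite addr_eq0 /graded_ext => /eqP -> .
by rewrite -sumrN !big_seq; apply: eq_bigr => q /hs /HN ->; rewrite opprK.
Qed.

Lemma graded_ext_homog n x : homog V n x -> graded_ext H x = H (n, x).
Proof.
move=> hx; have := @graded_extE [:: (n, x)]; rewrite !big_seq1; apply=> q.
by rewrite inE => /eqP ->.
Qed.

Lemma graded_ext_linear : linear (graded_ext H).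
Proof.
move=> c x y; rewrite {1}[x]homog_decE {1}[y]homog_decE scaler_sumr.
pose t := [seq (q.1, c *: q.2) | q <- homog_dec x] ++ homog_dec y.
have ht q : q \in t -> homog V q.1 q.2.
  rewrite mem_cat => /orP[/mapP[r /homog_dec_homog + ->] /=|/homog_dec_homog//].
  exact: homogZ.
have := graded_extE ht; rewrite !big_cat !big_map /= => ->; congr (_ + _).
rewrite scaler_sumr !big_seq; apply: eq_bigr => -[n z] /homog_dec_homog /= hz.
by have := hH c hz (homog0 n); rewrite hlin0 !addr0.
Qed.
End Extension.

Lemma eq_on_homog W (L L' : V -> W) : linear L -> linear L' ->
  (forall n x, homog V n x -> L x = L' x) -> L =1 L'.
Proof.
move=> hL hL' h x; rewrite [x]homog_decE (lin_sum hL) (lin_sum hL') big_seq [RHS]big_seq.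
by apply: eq_bigr => q /homog_dec_homog; apply: h.
Qed.

Definition gproj (i : int) : V -> V := graded_ext (fun q => if q.1 == i then q.2 else 0).

Lemma gproj_hlinear i :
  @homog_linear V (fun q => if q.1 == i then q.2 else 0).
Proof. by move=> n c x y _ _ /=; case: eqP; rewrite ?scaler0 ?addr0. Qed.

Lemma gproj_linear i : linear (gproj i).
Proof. exact: graded_ext_linear (@gproj_hlinear i). Qed.

Lemma gproj_id i x : homog V i x -> gproj i x = x.
Proof. by move=> hx; rewrite /gproj (graded_ext_homog (@gproj_hlinear i) hx) /= eqxx. Qed.

Lemma gproj_homog i x : homog V i (gproj i x).
Proof.
apply: homog_sum => -[n y] /homog_dec_homog /= hy _.
by case: eqP => [<-|_] //; apply: homog0.
Qed.

End GradedExtension.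

(** A vector together with a degree in which it is homogeneous; the degree is
    part of the data because 0 has every degree. *)
Record hletter (K : fieldType) (V : gspace K) := HLetter {
  ldeg : int; lval : V; lvalP : homog V ldeg lval }.

(** * The universal property of the symmetric algebra *)

Section SymWords.
Variables (K : fieldType) (V : gspace K) (gV : graded V).
Notation E := (hletter V).
Notation deg := (@ldeg K V).
Implicit Types (s p : seq E) (e u v : E) (W : lmodType K).

(** The projection makes this letter depend linearly on x, for all x, while it
    does not change an x of degree i. *)
Definition mk (i : int) (x : V) : E := HLetter (gproj_homog gV i x).

Lemma lval_mk i x : homog V i x -> lval (mk i x) = x.
Proof. exact: gproj_id. Qed.

Lemma mk_lval e : mk (ldeg e) (lval e) = e.
Proof.
case: e => i x hx; rewrite /mk /=.
have h := gproj_id gV hx; move: (gproj_homog gV i x); rewrite h => hx'.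
by congr HLetter; apply: Prop_irrelevance.
Qed.

Definition multilin W (F : seq E -> W) :=
  forall p i s, linear (fun x => F (p ++ mk i x :: s)).

Notation gsym := (gsym deg).

Lemma multilin_cons W (F : seq E -> W) e : multilin F -> multilin (fun s => F (e :: s)).
Proof. by move=> h p; apply: (h (e :: p)). Qed.
(** The extension of F to words in arbitrary vectors, by multilinearity. *)
Fixpoint word_ext W (F : seq E -> W) (s : seq V) : W :=
  if s is x :: s' then
    graded_ext gV (fun q => word_ext (fun t => F (mk q.1 q.2 :: t)) s') x
  else F [::].

Lemma eq_word_ext W (F F' : seq E -> W) (s : seq V) : F =1 F' -> word_ext F s = word_ext F' s.
Proof.
elim: s F F' => [|x s IH] F F' h /=; first exact: h.
by apply: eq_bigr => q _; apply: IH => t; apply: h.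
Qed.

Lemma word_ext_lin W k (F F' : seq E -> W) (s : seq V) :
  word_ext (fun t => k *: F t + F' t) s = k *: word_ext F s + word_ext F' s.
Proof.
elim: s F F' => [|x s IH] F F' //=; rewrite /graded_ext scaler_sumr -big_split /=.
by apply: eq_bigr => q _; apply: IH.
Qed.

Lemma word_extZ W k (F : seq E -> W) (s : seq V) :
  word_ext (fun t => k *: F t) s = k *: word_ext F s.
Proof.
elim: s F => [|x s IH] F //=; rewrite /graded_ext scaler_sumr.
by apply: eq_bigr => q _; apply: IH.
Qed.

Lemma word_ext_hlinear W (F : seq E -> W) (s : seq V) : multilin F ->
  homog_linear (fun q => word_ext (fun t => F (mk q.1 q.2 :: t)) s).
Proof.
move=> h n c x y _ _ /=; rewrite -word_ext_lin; apply: eq_word_ext => t.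
exact: (h [::]).
Qed.

Lemma word_ext_cons W (F : seq E -> W) e (s : seq V) : multilin F ->
  word_ext F (lval e :: s) = word_ext (fun t => F (e :: t)) s.
Proof.
move=> h /=; rewrite (graded_ext_homog gV (word_ext_hlinear s h) (lvalP e)) /=.
by rewrite mk_lval.
Qed.

Lemma word_ext_lval W (F : seq E -> W) s : multilin F ->
  word_ext F (map (@lval K V) s) = F s.
Proof.
elim: s F => [|e s IH] F h //; rewrite map_cons word_ext_cons // IH //.
exact: multilin_cons.
Qed.

Lemma word_ext_linear W (F : seq E -> W) (p s : seq V) : multilin F ->
  linear (fun x => word_ext F (p ++ x :: s)).
Proof.
elim: p F => [|y p IH] F h.
  by apply: graded_ext_linear; apply: word_ext_hlinear.
move=> c x x' /=; rewrite /graded_ext scaler_sumr -big_split /=.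
by apply: eq_bigr => q _; apply: IH; apply: multilin_cons.
Qed.

Lemma word_ext_swap W (F : seq E -> W) (p : seq V) u v (s : seq V) : multilin F -> gsym F ->
  word_ext F (p ++ lval u :: lval v :: s) =
  sgn (ldeg u * ldeg v) *: word_ext F (p ++ lval v :: lval u :: s).
Proof.
elim: p F => [|y p IH] F h hs.
  rewrite !cat0s word_ext_cons // word_ext_cons; last exact: multilin_cons.
  rewrite [in RHS]word_ext_cons // [in RHS]word_ext_cons; last exact: multilin_cons.
  by rewrite -word_extZ; apply: eq_word_ext => t; apply: (hs [::]).
rewrite !cat_cons /= /graded_ext scaler_sumr; apply: eq_bigr => q _.
by apply: IH; [apply: multilin_cons|apply: gsym_cons].
Qed.

Definition wprod s : sym_type V := sym_prod (map (@lval K V) s).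

Lemma sym_prod_cons x (s : seq V) : sym_prod (x :: s) = sym_in x * sym_prod s.
Proof. by rewrite /sym_prod big_cons. Qed.

Lemma sym_prod_cat (s t : seq V) : sym_prod (s ++ t) = sym_prod s * sym_prod t.
Proof. by rewrite /sym_prod big_cat. Qed.

Lemma sym_pi_word (w : seq V) : sym_pi << FMonom w >> = sym_prod w.
Proof.
elim: w => [|x t IH].
  by rewrite /sym_prod big_nil -fmoneE.
rewrite sym_prod_cons -IH sym_in.unlock -sym_piM; congr sym_pi.
rewrite /letter [RHS]fgmulUU mulr1; congr << _ >>.
by rewrite /mmul /= fmmulE fmuE.
Qed.

Section FreeExtension.
Variables (W : lmodType K) (H : {fmonom V} -> W).
Notation T := ({malg K[{fmonom V}]}).
(** The linear extension of H from words to the free associative algebra. *)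
Definition free_ext (a : T) : W := \sum_(k <- msupp a) a@_k *: H k.

Lemma free_extEw (d : {fset {fmonom V}}) (a : T) : (msupp a `<=` d)%fset ->
  free_ext a = \sum_(k <- d) a@_k *: H k.
Proof.
move=> le; rewrite [LHS](big_fset_incl _ le) => //= x xd /mcoeff_outdom ->.
by rewrite scale0r.
Qed.

Lemma free_ext_linear : linear free_ext.
Proof.
move=> c a b; pose d := (msupp a `|` msupp b)%fset.
have hb : (msupp b `<=` d)%fset by apply: fsubsetUr.
have ha : (msupp a `<=` d)%fset by apply: fsubsetUl.
have hc : (msupp (c *: a + b) `<=` d)%fset.
  apply: fsubset_trans (msuppD_le _ _) _; rewrite fsubUset hb andbT.
  exact: fsubset_trans (msuppZ_le _ _) ha.
rewrite (free_extEw ha) (free_extEw hb) (free_extEw hc) scaler_sumr -big_split /=.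
by apply: eq_bigr => k _; rewrite mcoeffD mcoeffZ scalerDl scalerA.
Qed.

Lemma free_extU k : free_ext << k >> = H k.
Proof. by rewrite (free_extEw msuppU_le) big_seq_fset1 mcoeffUU scale1r. Qed.

Lemma malg_span (a : T) : a = \sum_(k <- msupp a) a@_k *: << k >>.
Proof.
apply/malgP => m; rewrite {1}[a]monalgE !raddf_sum /=; apply: eq_bigr => k _.
by rewrite mcoeffZ !mcoeffU; case: eqP; rewrite ?mulr1 ?mulr0.
Qed.

(** The ideal is spanned by relations multiplied by words on both sides, and
    there the hypotheses are what is required. *)
Lemma free_ext_ideal (x : T) :
  (forall k l (c : K) (u v : V), H (mmul (mmul k (fmu (c *: u + v))) l) =
     c *: H (mmul (mmul k (fmu u)) l) + H (mmul (mmul k (fmu v)) l)) ->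
  (forall k l i j (u v : V), homog V i u -> homog V j v ->
     H (mmul (mmul k (mmul (fmu u) (fmu v))) l) =
     (-1) ^ (i * j) *: H (mmul (mmul k (mmul (fmu v) (fmu u))) l)) ->
  sym_ideal x -> free_ext x = 0.
Proof.
move=> h1 h2; have L := free_ext_linear; elim=> [|a r b y hr _ IH].
  exact: (lin0 L).
have La : linear (fun a => free_ext (a * r * b)).
  by move=> c u v; rewrite !mulrDl -!scalerAl L.
have Lb k : linear (fun b => free_ext (<< k >> * r * b)).
  by move=> c u v; rewrite mulrDr -malg_scalerAr L.
rewrite (linD L) IH addr0 [X in free_ext (X * _ * _)]malg_span (lin_sum La).
rewrite big1 // => k _; rewrite (linZ La) [X in free_ext (_ * X)]malg_span (lin_sum (Lb _)).
rewrite big1 ?scaler0 // => l _; rewrite (linZ (Lb _)).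
suff -> : free_ext (<< k >> * r * << l >>) = 0 by rewrite scaler0.
have U (m n : {fmonom V}) : << m >> * << n >> = << mmul m n >> :> T.
  by rewrite [LHS]fgmulUU mulr1.
case: hr => [c u v|i j u v hu hv]; rewrite /letter.
  rewrite mulrBr mulrDr mulrBl mulrDl -malg_scalerAr -scalerAl !U.
  by rewrite (linB L) (linD L) (linZ L) !free_extU h1 subrr.
rewrite mulrBr mulrBl !U -malg_scalerAr -scalerAl !U (linB L) (linZ L) !free_extU.
by rewrite (h2 _ _ i j) // subrr.
Qed.
End FreeExtension.

(** F extends to words in all vectors, then linearly to the free algebra; the
    relations of the symmetric algebra go to 0 because F is multilinear and
    graded symmetric. *)
Lemma Sym_ext W (F : seq E -> W) : multilin F -> gsym F ->
  exists2 phi : sym_type V -> W, linear phi & forall s, phi (wprod s) = F s.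
Proof.
move=> hl hs; pose H (k : {fmonom V}) := word_ext F (fmonom_val k).
have mmE (k l : {fmonom V}) : fmonom_val (mmul k l) = k ++ l :> seq V.
  by rewrite /mmul /= fmmulE.
have fuE (x : V) : fmonom_val (fmu x) = [:: x] by rewrite fmuE.
have id0 (a : {malg K[{fmonom V}]}) : sym_ideal a -> free_ext H a = 0.
  apply: free_ext_ideal => [k l c u v|k l i j u v hu hv].
    rewrite /H !mmE !fuE -!catA; exact: word_ext_linear.
  rewrite /H !mmE !fuE -!catA /=.
  exact: (@word_ext_swap _ F _ (HLetter hu) (HLetter hv)).
have L := free_ext_linear H.
pose phi (x : sym_type V) := free_ext H (generic_quotient.repr x).
have phiE a : phi (sym_pi a) = free_ext H a.
  apply/eqP; rewrite -subr_eq0 -(linB L); apply/eqP/id0.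
  by apply/sym_pi_eq; rewrite sym_piK.
exists phi.
  move=> c x y; rewrite -[x in LHS]sym_piK -[y in LHS]sym_piK -sym_piZ -sym_piD.
  by rewrite phiE L.
move=> s; rewrite /wprod -sym_pi_word phiE free_extU /H /= word_ext_lval //.
Qed.

End SymWords.

(** * Sums over permutations that are increasing on blocks *)

Section OrdinalLists.
Variable T : Type.

Lemma iota_insert p j : (j <= p)%N ->
  iota 0 p.+1 = take j (map (bump j) (iota 0 p)) ++ j :: drop j (map (bump j) (iota 0 p)).
Proof.
move=> hj; have hs : size (map (bump j) (iota 0 p)) = p by rewrite size_map size_iota.
apply: (@eq_from_nth _ 0%N).
  by rewrite size_cat /= size_take size_drop hs size_iota; case: ifP; lia.
move=> i; rewrite size_iota => hi; rewrite nth_iota // nth_cat size_take hs.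
have -> : (if (j < p)%N then j else p) = j by case: ifP; lia.
case: ltnP => hij.
  by rewrite nth_take // (nth_map 0%N) ?size_iota ?nth_iota /bump; lia.
case: (posnP (i - j)) => [e|h]; first by rewrite e /=; lia.
rewrite -(prednK h) /= nth_drop (nth_map 0%N) ?size_iota ?nth_iota /bump; lia.
Qed.

Lemma enum_lift p (j : 'I_p.+1) :
  enum 'I_p.+1 = take j (map (lift j) (enum 'I_p)) ++ j :: drop j (map (lift j) (enum 'I_p)).
Proof.
apply: (inj_map val_inj); rewrite val_enum_ord map_cat map_cons map_take map_drop.
rewrite -map_comp (eq_map (g := bump j \o val)) // map_comp val_enum_ord.
exact/iota_insert/leq_ord.
Qed.

Lemma take_enum_ord p k : take k (enum 'I_p) = [seq i : 'I_p <- enum 'I_p | (i < k)%N].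
Proof.
apply: (inj_map val_inj); rewrite map_take val_enum_ord.
have -> : [seq val i | i <- [seq i : 'I_p <- enum 'I_p | (i < k)%N]] =
   [seq i <- iota 0 p | (i < k)%N].
  by rewrite -val_enum_ord filter_map.
case: (leqP k p) => h; last first.
  rewrite take_oversize ?size_iota ?(ltnW h) //.
  rewrite (eq_in_filter (a2 := xpredT)) ?filter_predT // => i; rewrite mem_iota; lia.
have -> : p = (k + (p - k))%N by lia.
rewrite iotaD filter_cat take_cat size_iota ltnn subnn take0 cats0 add0n.
rewrite (eq_in_filter (a2 := xpredT)) ?filter_predT; last first.
  by move=> i; rewrite mem_iota /= => h'; lia.
rewrite [X in _ ++ X](eq_in_filter (a2 := pred0)) ?filter_pred0 ?cats0 //.
by move=> i; rewrite mem_iota /= => h'; lia.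
Qed.

Lemma sum_take_ord (U : nmodType) p k (F : 'I_p -> U) (f : 'I_p -> T) (G : T -> U) :
  (forall i, G (f i) = F i) ->
  \sum_(x <- take k [seq f i | i <- enum 'I_p]) G x = \sum_(i < p | (i < k)%N) F i.
Proof.
move=> h; rewrite -map_take take_enum_ord big_map big_filter big_enum_cond /=.
by apply: eq_bigr => i _; rewrite h.
Qed.

Lemma map_lift_perm p (e : 'I_p.+1 -> T) j (s : 'S_p) :
  [seq e (lift_perm j ord0 s i) | i <- enum 'I_p.+1] =
  let w := [seq e (lift ord0 (s i)) | i <- enum 'I_p] in
  take j w ++ e ord0 :: drop j w.
Proof.
rewrite (enum_lift j) map_cat map_cons lift_perm_id map_take map_drop -map_comp.
have -> : [seq ((fun i => e (lift_perm j ord0 s i)) \o lift j) i | i <- enum 'I_p] =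
   [seq e (lift ord0 (s i)) | i <- enum 'I_p].
  by apply: eq_map => i /=; rewrite lift_perm_lift.
by [].
Qed.
End OrdinalLists.

(** Every permutation takes the value 0 at one place j, and the rest is a
    permutation of one object less. *)
Lemma sum_perm_lift (W : nmodType) p (P : pred 'S_p.+1) (F : 'S_p.+1 -> W) :
  \sum_(s | P s) F s =
  \sum_(j < p.+1) \sum_(s : 'S_p | P (lift_perm j ord0 s)) F (lift_perm j ord0 s).
Proof.
pose f (q : 'I_p.+1 * 'S_p) := lift_perm q.1 ord0 q.2.
have fi : injective f.
  move=> [j s] [j' s'] /= e; rewrite /f /= in e.
  have ej : j = j' by apply: (@perm_inj _ (lift_perm j ord0 s)); rewrite {2}e !lift_perm_id.
  subst j'; congr pair; apply/permP => i; apply: (@lift_inj _ ord0).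
  by rewrite -!(lift_perm_lift j) e.
rewrite (reindex f) /=.
  by rewrite pair_big_dep.
apply/onW_bij/(inj_card_bij fi); rewrite card_prod !card_Sn card_ord factS //.
Qed.

(** C labels the positions by blocks. *)
Definition blocked (p : nat) (C : nat -> nat) (s : 'S_p) : bool :=
  [forall i : 'I_p, forall j : 'I_p, (i < j)%N && (C i == C j) ==> (s i < s j)%N].

Definition bfirst (C : nat -> nat) (j : nat) : bool :=
  all (fun i => C i != C j) (iota 0 j).

(** Where the value 0 is taken a block has to begin, since the permutation
    increases on it; the other positions see the order among themselves. *)
Lemma blocked_lift p C (j : 'I_p.+1) (s : 'S_p) :
  blocked C (lift_perm j ord0 s) = bfirst C j && blocked (C \o bump j) s.
Proof.
apply/forallP/andP => [h|[/allP h1 /forallP h2] x].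
  split.
    apply/allP => i; rewrite mem_iota add0n => /andP[_ hi].
    apply/negP => /eqP e; pose i' := Ordinal (ltn_trans hi (ltn_ord j)).
    by have /forallP/(_ j) := h i'; rewrite /= hi e eqxx /= lift_perm_id ltn0.
  apply/forallP => x; apply/forallP => y; apply/implyP => /andP[hxy /= hC].
  have /forallP/(_ (lift j y))/implyP := h (lift j x).
  rewrite /= hC !lift_perm_lift /= => H.
  have := H _; rewrite /bump in H *; lia.
apply/forallP => y; apply/implyP => /andP[hxy hC].
case: (unliftP j x) hxy hC => [x' ->|-> hxy hC]; last first.
  case: (unliftP j y) hxy => [y' ->|->]; rewrite ?ltnn // => _.
  by rewrite lift_perm_id lift_perm_lift.
case: (unliftP j y) => [y' ->|->] hxy hC; last first.
  by have := h1 (lift j x'); rewrite mem_iota hxy hC => /(_ isT).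
have /forallP/(_ y')/implyP := h2 x'; rewrite !lift_perm_lift /= hC => H.
have := H _; move: hxy; rewrite /= /bump; lia.
Qed.

Section KoszulRec.
Variable K : fieldType.

(** The inversions involving the value 0 are those with the positions to its
    left. *)
Lemma koszul_lift p (j : 'I_p.+1) (s : 'S_p) (a : 'I_p.+1 -> int) :
  koszul K (lift_perm j ord0 s) a =
  sgn (a ord0 * \sum_(i < p | (i < j)%N) a (lift ord0 (s i)))
  * koszul K s (a \o lift ord0).
Proof.
rewrite /koszul (bigD1_ord j) //= [X in X * _]big_pred0 ?mul1r; last first.
  by move=> k; rewrite lift_perm_id ltn0 andbF.
have -> : sgn (a ord0 * \sum_(i < p | (i < j)%N) a (lift ord0 (s i))) =
    \prod_(i < p) (if (i < j)%N then (-1) ^ (a (lift ord0 (s i)) * a ord0) else 1) :> K.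
  rewrite -big_mkcond mulr_sumr (big_morph _ (@sgnD K) (sgn0 K)).
  by apply: eq_bigr => i _; rewrite mulrC.
rewrite -big_split; apply: eq_bigr => i _ /=.
rewrite big_mkcond (bigD1_ord j) //= lift_perm_id !lift_perm_lift /=.
rewrite [in RHS]big_mkcond; congr (_ * _).
  by rewrite /bump andbT; have -> : ((j <= i) + i < j)%N = (i < j)%N by lia.
apply: eq_bigr => k _; rewrite !lift_perm_lift /=.
by rewrite /bump; have -> : ((j <= i) + i < (j <= k) + k)%N = (i < k)%N by lia.
Qed.

Variables (E : Type) (deg : E -> int).
Notation wdeg := (word_deg deg).

(** Three consecutive blocks; the first two have sizes l0 and l1. *)
Definition col3 (l0 l1 i : nat) : nat := (l0 <= i) + (l0 + l1 <= i).

Lemma bfirst_col3 l0 l1 j : bfirst (col3 l0 l1) j =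
  [|| (0 < l0)%N && (j == 0)%N, (0 < l1)%N && (j == l0) | (j == l0 + l1)%N].
Proof.
apply/allP/idP => h.
  have H i : (i < j)%N -> col3 l0 l1 i != col3 l0 l1 j.
    by move=> hi; apply: h; rewrite mem_iota.
  rewrite /col3 in H.
  case: (ltnP j l0) => h0.
    case: (posnP j) => [->|hj]; first by lia.
    by have := H 0%N hj; lia.
  case: (ltnP j (l0 + l1)) => h1.
    case: (eqVneq j l0) => [->|hj]; first by lia.
    have : (l0 < j)%N by lia.
    by move/H; lia.
  case: (eqVneq j (l0 + l1)%N) => [->|hj]; first by lia.
  have : (l0 + l1 < j)%N by lia.
  by move/H; lia.
by move=> i; rewrite mem_iota /col3; lia.
Qed.

Lemma cop3_0 (W : lmodType K) s : coprod3 deg (fun _ _ _ => 0 : W) s = 0.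
Proof.
rewrite -[RHS](scale0r (coprod3 deg (fun _ _ _ => 0 : W) s)) -cop3Z.
by apply: eq_cop3 => a b c _ _; rewrite scaler0.
Qed.

(** The recursion of [coprod3] on the first letter of the word corresponds to
    the place at which a permutation takes the value 0: this is the beginning of
    one of the three blocks, and the Koszul sign is that of moving the first
    letter past the preceding blocks. *)
Lemma blocked_sum p (e : 'I_p -> E) l0 l1 (W : lmodType K)
    (T : seq E -> seq E -> seq E -> W) : (l0 + l1 <= p)%N ->
  \sum_(s : 'S_p | blocked (col3 l0 l1) s)
     (let w := [seq e (s i) | i <- enum 'I_p] in
      koszul K s (deg \o e) *: T (take l0 w) (take l1 (drop l0 w)) (drop (l0 + l1) w))
  = coprod3 deg (fun a b c => if (size a == l0) && (size b == l1) then T a b c else 0)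
      [seq e i | i <- enum 'I_p].
Proof.
elim: p e l0 l1 T => [|p IH] e l0 l1 T hl.
  have e0 : enum 'I_0 = [::] by apply/size0nil; rewrite size_enum_ord.
  have [-> ->] : l0 = 0%N /\ l1 = 0%N by lia.
  rewrite e0 /= (big_pred1 1%g) /=; first by rewrite /koszul big_ord0 scale1r.
  move=> s; rewrite /= (_ : s = 1%g) ?eqxx; last by apply/permP => -[].
  by apply/forallP => -[].
pose f := e \o lift ord0.
pose w0 := [seq f i | i <- enum 'I_p].
have -> : [seq e i | i <- enum 'I_p.+1] = e ord0 :: w0.
  by rewrite (enum_lift ord0) take0 drop0 /= -map_comp.
pose G (j : nat) := \sum_(s : 'S_p | blocked (col3 l0 l1 \o bump j) s)
   (let w := [seq f (s i) | i <- enum 'I_p] in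
    let w' := take j w ++ e ord0 :: drop j w in
    koszul K s (deg \o f) *: (sgn (deg (e ord0) * wdeg (take j w)) *:
    T (take l0 w') (take l1 (drop l0 w')) (drop (l0 + l1) w'))).
rewrite sum_perm_lift.
transitivity (\sum_(j < p.+1 | bfirst (col3 l0 l1) j) G j).
  rewrite [RHS]big_mkcond; apply: eq_bigr => j _ /=.
  rewrite (eq_bigl _ _ (blocked_lift _ j)); case: (bfirst _ _); last first.
    by rewrite big_pred0.
  apply: eq_bigr => s _; rewrite map_lift_perm koszul_lift /= mulrC -scalerA.
  congr (_ *: (sgn (_ * _) *: _)).
  by rewrite /word_deg (@sum_take_ord _ _ _ _ (fun i => deg (e (lift ord0 (s i))))).
transitivity ((if (0 < l0)%N then G 0%N else 0) + (if (0 < l1)%N then G l0 else 0)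
    + (if (l0 + l1 < p.+1)%N then G (l0 + l1)%N else 0)).
  have -> : (if (l0 + l1 < p.+1)%N then G (l0 + l1)%N else 0) =
     \sum_(j < p.+1 | j == (l0 + l1)%N :> nat) G j by rewrite big_ord1_eq.
  have -> : (if (0 < l0)%N then G 0%N else 0) =
     \sum_(j < p.+1 | (0 < l0)%N && (j == 0 :> nat)) G j.
    by rewrite (big_ord1_cond_eq _ G (fun=> 0 < l0)%N).
  have -> : (if (0 < l1)%N then G l0 else 0) =
     \sum_(j < p.+1 | (0 < l1)%N && (j == l0 :> nat)) G j.
    rewrite (big_ord1_cond_eq _ G (fun=> 0 < l1)%N).
    by case: (ltnP 0 l1) => h; rewrite ?andbF ?andbT //; have -> : (l0 < p.+1)%N by lia.
  rewrite big_mkcond [X in _ = X + _ + _]big_mkcond [X in _ = _ + X + _]big_mkcond.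
  rewrite [X in _ = _ + _ + X]big_mkcond -!big_split; apply: eq_bigr => j _ /=.
  rewrite bfirst_col3.
  case: (boolP ((0 < l0)%N && (j == 0 :> nat))) => h1;
  case: (boolP ((0 < l1)%N && (j == l0 :> nat))) => h2;
  case: (boolP (j == (l0 + l1)%N :> nat)) => h3; rewrite /= ?addr0 ?add0r //; lia.
rewrite /=; congr (_ + _ + _).
- case: l0 hl @G => [|l0] hl G; first by rewrite cop3_0.
  rewrite /G; have {}IH := IH f l0 l1 (fun a b c => T (e ord0 :: a) b c).
  rewrite /= -IH; last by lia.
  apply: eq_big => [s|s _]; last first.
    by rewrite /= take0 drop0 /= wdeg_nil mulr0 sgn0 scale1r.
  apply: eq_forallb => i; apply: eq_forallb => k /=.
  by rewrite /col3 /bump /=; congr (_ ==> _); congr (_ && _); lia.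
- case: l1 hl @G => [|l1] hl G.
    rewrite (_ : (fun _ _ _ => _) = fun _ _ _ => 0) ?cop3_0 //.
    by apply/funext => a; apply/funext => b; apply/funext => c /=; rewrite andbF scaler0.
  rewrite /G; have {}IH := IH f l0 l1 (fun a b c =>
     sgn (deg (e ord0) * wdeg a) *: T a (e ord0 :: b) c).
  transitivity (coprod3 deg (fun a b c => if (size a == l0) && (size b == l1) then
     sgn (deg (e ord0) * wdeg a) *: T a (e ord0 :: b) c else 0) w0); last first.
    by apply: eq_cop3 => a b c _ _; rewrite /= eqSS; case: ifP; rewrite ?scaler0.
  rewrite -IH; last by lia.
  apply: eq_big => [s|s _]; last first.
    rewrite /=; set w := map _ _.
    have hw : size (take l0 w) = l0.
      by rewrite size_takel // size_map size_enum_ord; lia.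
    rewrite take_size_cat // drop_size_cat //= drop_cat hw ltnNge leq_addr /=.
    by rewrite addKn /= drop_drop addnC.
  apply: eq_forallb => i; apply: eq_forallb => k /=.
  by rewrite /col3 /bump /=; congr (_ ==> _); congr (_ && _); lia.
- case: ltnP => hp; last first.
    rewrite (@eq_cop3 _ _ _ _ _ (fun _ _ _ => 0)) ?cop3_0 // => a b c _.
    rewrite /= size_map size_enum_ord => hs; case: andP => [[/eqP ha /eqP hb]|_]; rewrite ?scaler0
      //; lia.
  rewrite /G; have {}IH := IH f l0 l1 (fun a b c =>
     sgn (deg (e ord0) * (wdeg a + wdeg b)) *: T a b (e ord0 :: c)).
  transitivity (coprod3 deg (fun a b c => if (size a == l0) && (size b == l1) then
     sgn (deg (e ord0) * (wdeg a + wdeg b)) *: T a b (e ord0 :: c) else 0) w0); last first.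
    by apply: eq_cop3 => a b c _ _; case: ifP; rewrite ?scaler0.
  rewrite -IH; last by lia.
  apply: eq_big => [s|s _]; last first.
    rewrite /=; set w := map _ _.
    have hw : size w = p by rewrite size_map size_enum_ord.
    have e1 : take (l0 + l1) w = take l0 w ++ take l1 (drop l0 w) by rewrite takeD.
    have hA : size (take l0 w) = l0 by rewrite size_takel // hw; lia.
    have hB : size (take l1 (drop l0 w)) = l1 by rewrite size_takel // size_drop hw; lia.
    rewrite e1 wdeg_cat [drop (l0 + l1) (_ ++ _)]drop_size_cat ?size_cat ?hA ?hB //.
    by rewrite -catA take_size_cat // drop_size_cat // take_size_cat.
  apply: eq_forallb => i; apply: eq_forallb => k /=.
  by rewrite /col3 /bump /=; congr (_ ==> _); congr (_ && _); lia.
Qed.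
End KoszulRec.

(** * The formulas of the theorem on words *)

Lemma shuffle3E p (s : 'S_p) (l0 l1 : nat) : (l0 + l1 <= p)%N ->
  shuffle [:: l0%:Z; l1%:Z; p%:Z - l0%:Z - l1%:Z] s = blocked (col3 l0 l1) s.
Proof.
move=> h; have e : p%:Z - l0%:Z - l1%:Z = (p - l0 - l1)%N%:Z by lia.
rewrite /shuffle e /= !big_cons big_nil /=.
have -> : (l0%:Z + (l1%:Z + ((p - l0 - l1)%N%:Z + 0)) == p%:Z) = true.
  by apply/eqP; lia.
apply: eq_forallb => i; apply: eq_forallb => j.
have R (k : 'I_p) : reshape_index [:: l0; l1; (p - l0 - l1)%N] k = col3 l0 l1 k.
  rewrite /reshape_index /col3 /=; have := ltn_ord k; move: (nat_of_ord k) => k' hk.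
  by repeat case: eqP => /=; lia.
by rewrite -!R.
Qed.

Lemma shuffle3_neg p (s : 'S_p) (b0 b1 b2 : int) : (b0 < 0) || (b1 < 0) || (b2 < 0) ->
  shuffle [:: b0; b1; b2] s = false.
Proof. by rewrite /shuffle /= !leNgt; do 3 case: (_ < 0). Qed.

Lemma shuffle2E p (s : 'S_p) (l0 : nat) : (l0 <= p)%N ->
  shuffle [:: l0%:Z; (p - l0)%N%:Z] s = blocked (col3 l0 (p - l0)) s.
Proof.
move=> h; rewrite /shuffle /= !big_cons big_nil /=.
have -> : (l0%:Z + ((p - l0)%N%:Z + 0) == p%:Z) = true by apply/eqP; lia.
apply: eq_forallb => i; apply: eq_forallb => j.
have R (k : 'I_p) : reshape_index [:: l0; (p - l0)%N] k = col3 l0 (p - l0) k.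
  rewrite /reshape_index /col3 /=; have := ltn_ord k; move: (nat_of_ord k) => k' hk.
  by repeat case: eqP => /=; lia.
by rewrite -!R.
Qed.

Section FrontForms.
Variables (K : fieldType) (E : Type) (deg : E -> int).
Notation cop2 := (coprod2 deg).
Notation cop3 := (coprod3 deg).
Notation dr := (letter_deriv deg).
Notation gsym := (gsym deg).
Implicit Types (W : lmodType K).

Lemma cop2_0 W s : cop2 (fun _ _ => 0 : W) s = 0.
Proof.
rewrite -[RHS](scale0r (cop2 (fun _ _ => 0 : W) s)) -cop2Z.
by apply: eq_cop2 => a b _ _; rewrite scaler0.
Qed.

Lemma cop3_sum (W : lmodType K) n (T : nat -> seq E -> seq E -> seq E -> W) s :
  \sum_(i < n) cop3 (T i) s = cop3 (fun a b c => \sum_(i < n) T i a b c) s.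
Proof.
elim: n => [|n IH].
  by rewrite big_ord0 -[LHS](cop3_0 deg W s); apply: eq_cop3 => a b c _ _; rewrite big_ord0.
rewrite big_ord_recr /= IH -cop3D; apply: eq_cop3 => a b c _ _.
by rewrite big_ord_recr.
Qed.

Lemma cop2_nill W (U : seq E -> W) s :
  cop2 (fun a b => if a is [::] then U b else 0) s = U s.
Proof.
elim: s U => [|v s IH] U //=; rewrite cop2_0 add0r -[RHS](IH (fun b => U (v :: b))).
apply: eq_cop2 => -[|x a] b _ _; last by rewrite scaler0.
by rewrite wdeg_nil mulr0 sgn0 scale1r.
Qed.

Lemma cop2_nilr W (U : seq E -> W) s :
  cop2 (fun a b => if b is [::] then U a else 0) s = U s.
Proof.
elim: s U => [|v s IH] U //=; rewrite [X in _ + X](@eq_cop2 _ _ _ _ _ (fun _ _ => 0)).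
  by rewrite cop2_0 addr0 (IH (fun a => U (v :: a))).
by move=> a b _ _; rewrite scaler0.
Qed.

(** By symmetry the letter on which a derivation acts can be moved to the front,
    where it is the left part of a splitting. *)
Lemma dr_front n D W (phi : seq E -> W) s :
  (forall v, deg (D v) = deg v + n) -> gsym phi ->
  cop2 (fun b c => if b is [:: x] then phi (D x :: c) else 0) s = dr n D phi s.
Proof.
move=> hD; elim: s phi => [|v s IH] phi h //=; congr (_ + _).
  rewrite -(cop2_nill (fun c => phi (D v :: c))); apply: eq_cop2 => -[|x a] b _ _ //.
rewrite -(IH _ (gsym_cons v h)) -cop2Z; apply: eq_cop2 => -[|x [|y a]] b _ _;
  rewrite ?scaler0 //.
rewrite (h [::]) /= scalerA wdeg_cons wdeg_nil addr0 hD -sgnD.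
by congr (_ *: _); sgn_eq.
Qed.

(** Two blocks are three blocks of which the last is empty. *)
Lemma sum_2blocks p (e : 'I_p -> E) W (T : seq E -> seq E -> W) :
  \sum_(l < p.+1) \sum_(s : 'S_p | shuffle [:: l%:Z; (p - l)%N%:Z] s)
     (let w := [seq e (s i) | i <- enum 'I_p] in
      koszul K s (deg \o e) *: T (take l w) (drop l w))
  = cop2 T [seq e i | i <- enum 'I_p].
Proof.
transitivity (\sum_(l < p.+1) cop3 (fun a b c =>
    if (size a == l) && (size b == p - l)%N then T a b else 0)
    [seq e i | i <- enum 'I_p]).
  apply: eq_bigr => l _; have hl : (l <= p)%N by rewrite -ltnS.
  rewrite -(@blocked_sum _ _ deg _ e l (p - l) _ (fun a b _ => T a b)); last by lia.
  apply: eq_big => [s|s _]; first exact: shuffle2E.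
  rewrite /= [take (p - l) _]take_oversize // size_drop size_map size_enum_ord //.
rewrite (cop3_sum _ (fun l a b c => if (size a == l) && (size b == p - l)%N then T a b else 0)).
transitivity (cop3 (fun a b c => if c is [::] then T a b else 0)
    [seq e i | i <- enum 'I_p]).
  apply: eq_cop3 => a b c _; rewrite size_map size_enum_ord => hs.
  have ha : (size a < p.+1)%N by lia.
  rewrite (bigD1 (Ordinal ha)) //= eqxx big1 ?addr0 /=; last first.
    move=> i; rewrite -val_eqE /= eq_sym => /negbTE -> //.
  case: c hs => [|x c] /= hs; case: eqP => //; lia.
rewrite -cop3_l -[RHS](cop2_nilr (cop2 T)); apply: eq_cop2 => a b _ _.
by case: b => [|x b] //; rewrite cop2_0.
Qed.

(** The summand l = p is empty, as the last block would have size -1. *)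
Lemma sum_3blocks p (e : 'I_p -> E) W (T : seq E -> E -> seq E -> W) x0 :
  \sum_(l < p.+1) \sum_(s : 'S_p | shuffle [:: l%:Z; 1; p%:Z - l%:Z - 1] s)
     (let w := [seq e (s i) | i <- enum 'I_p] in
      koszul K s (deg \o e) *: T (take l w) (nth x0 w l) (drop l.+1 w))
  = cop2 (fun a => cop2 (fun b c => if b is [:: x] then T a x c else 0))
      [seq e i | i <- enum 'I_p].
Proof.
pose T' a b c := if b is [:: x] then T a x c else 0.
rewrite (cop3_r deg T') big_ord_recr /= [X in _ + X]big_pred0 ?addr0; last first.
  by move=> s; rewrite shuffle3_neg //; lia.
transitivity (\sum_(l < p) cop3 (fun a b c =>
    if (size a == l) && (size b == 1)%N then T' a b c else 0)
    [seq e i | i <- enum 'I_p]).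
  apply: eq_bigr => l _; have hl := ltn_ord l.
  rewrite -(@blocked_sum _ _ deg _ e l 1 _ T'); last by lia.
  apply: eq_big => [s|s _]; first by rewrite (@shuffle3E _ s l 1) //; lia.
  rewrite /=; set w := map _ _; have hw : size w = p by rewrite size_map size_enum_ord.
  by rewrite [drop l w](drop_nth x0) ?hw //= take0 addn1.
rewrite (cop3_sum _ (fun l a b c => if (size a == l) && (size b == 1)%N then T' a b c else 0)).
apply: eq_cop3 => a b c _; rewrite size_map size_enum_ord => hs.
case: b hs => [|x [|y b]] /= hs.
- by rewrite big1 // => i _; rewrite andbF.
- have ha : (size a < p)%N by lia.
  rewrite (bigD1 (Ordinal ha)) //= eqxx big1 ?addr0 //.
  by move=> i; rewrite -val_eqE /= eq_sym => /negbTE ->.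
- by rewrite big1 // => i _; rewrite andbF.
Qed.

Lemma enum_ordS p : enum 'I_p.+1 = ord0 :: map (lift ord0) (enum 'I_p).
Proof. by rewrite (enum_lift ord0) take0 drop0. Qed.

Lemma map_filter_ordS p (e : 'I_p.+1 -> E) (P : pred 'I_p.+1) :
  [seq e k | k <- enum 'I_p.+1 & P k] =
  (if P ord0 then [:: e ord0] else [::]) ++
   [seq e (lift ord0 k) | k <- enum 'I_p & P (lift ord0 k)].
Proof.
rewrite enum_ordS /= filter_map; case: (P ord0); rewrite /= -map_comp //.
Qed.

Lemma sum_ltnS p (F : 'I_p.+1 -> int) (j : 'I_p) :
  \sum_(k < p.+1 | (k < lift ord0 j)%N) F k =
  F ord0 + \sum_(k < p | (k < j)%N) F (lift ord0 k).
Proof.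
by rewrite big_mkcond big_ord_recl /= [in RHS]big_mkcond.
Qed.

(** The recursion of the sum over j is that of [letter_deriv], after the first
    letter is moved back past D (e j). *)
Lemma dr_sum n D W (phi : seq E -> W) p (e : 'I_p -> E) :
  (forall v, deg (D v) = deg v + n) -> gsym phi ->
  \sum_(j < p) sgn (deg (e j) * \sum_(k < p | (k < j)%N) deg (e k))
     *: phi (D (e j) :: [seq e k | k <- enum 'I_p & k != j])
  = dr n D phi [seq e k | k <- enum 'I_p].
Proof.
move=> hD; elim: p phi e => [|p IH] phi e h.
  by rewrite big_ord0 (size0nil (size_enum_ord 0)).
rewrite [in RHS]enum_ordS /= big_ord_recl -map_comp -(IH _ _ (gsym_cons _ h)).
congr (_ + _).
  rewrite big_pred0 ?mulr0 ?sgn0 ?scale1r; last by move=> k; rewrite ltn0.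
  rewrite map_filter_ordS /=; congr (phi (_ :: _)).
  by congr map; apply/all_filterP/allP.
rewrite scaler_sumr; apply: eq_bigr => j _; rewrite sum_ltnS.
rewrite map_filter_ordS /= (h [::]) /= hD !scalerA -!sgnD; congr (_ *: phi (_ :: _ :: _)).
  by sgn_eq.
Qed.

Variable br : E -> E -> E.
Hypothesis deg_br : forall v w, deg (br v w) = deg w + (deg v + 1).
Notation qd := (quad_deriv deg br).

(** The pairs with i = 0 give ad of the first letter; in the others the first
    letter is moved to the front, past a bracket of degree 1 more than its
    entries. *)
Lemma qd_sum W (phi : seq E -> W) p (e : 'I_p -> E) : gsym phi ->
  \sum_(i < p) \sum_(j < p | (i < j)%N)
    sgn (deg (e i) * (\sum_(k < p | (k < i)%N) deg (e k))
         + deg (e j) * (\sum_(k < p | (k < j)%N) deg (e k)) + deg (e i) * deg (e j))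
    *: phi (br (e i) (e j) :: [seq e k | k <- enum 'I_p & (k != i) && (k != j)])
  = qd phi [seq e k | k <- enum 'I_p].
Proof.
elim: p phi e => [|p IH] phi e h.
  by rewrite big_ord0 (size0nil (size_enum_ord 0)).
rewrite [in RHS]enum_ordS /= big_ord_recl -map_comp -(IH _ _ (gsym_cons _ h)).
rewrite -(dr_sum _ (deg_br _) h); congr (_ + _).
  rewrite big_mkcond big_ord_recl /= add0r; apply: eq_bigr => j _.
  rewrite sum_ltnS map_filter_ordS /= big_pred0; last by move=> k; rewrite ltn0.
  by congr (_ *: phi (_ :: _)); sgn_eq.
rewrite scaler_sumr; apply: eq_bigr => i _.
rewrite scaler_sumr big_mkcond big_ord_recl /= add0r [RHS]big_mkcond.
apply: eq_bigr => j _; rewrite /bump /= !add1n ltnS; case: ifP => // hij.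
rewrite !sum_ltnS map_filter_ordS /= (h [::]) /= deg_br !scalerA -!sgnD.
by congr (_ *: phi (_ :: _ :: _)); sgn_eq.
Qed.

End FrontForms.

(** * Preservation of multilinearity and symmetry *)

Section SymmetricWordFunctions.
Variables (K : fieldType) (V : gspace K) (gV : graded V).
Notation E := (hletter V).
Notation deg := (@ldeg K V).
Notation wdeg := (word_deg deg).
Notation mk := (mk gV).
Notation multilin := (multilin gV).
Notation gsym := (gsym deg).
Notation dr := (letter_deriv deg).
Notation cop2 := (coprod2 deg).
Implicit Types (s p : seq E) (e u v : E) (W : lmodType K).

Definition multisym W (F : seq E -> W) := multilin F /\ gsym F.

Lemma wdeg_mk p i x s : wdeg (p ++ mk i x :: s) = wdeg p + (i + wdeg s).
Proof. by rewrite wdeg_cat wdeg_cons. Qed.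

Lemma wdeg_swap p u v s : wdeg (p ++ u :: v :: s) = wdeg (p ++ v :: u :: s).
Proof. by rewrite !wdeg_cat !wdeg_cons [deg u + _]addrCA. Qed.

Lemma multisym_cons W (F : seq E -> W) e : multisym F -> multisym (fun s => F (e :: s)).
Proof. by case=> h1 h2; split; [apply: multilin_cons|apply: gsym_cons]. Qed.

(** L may depend on the degree of the word, which is the same for all terms of a
    relation. *)
Lemma multisym_comp (U W : lmodType K) (L : int -> U -> W) (F : seq E -> U) :
  (forall n, linear (L n)) -> multisym F -> multisym (fun s => L (wdeg s) (F s)).
Proof.
move=> hL [h1 h2]; split=> [p i s c x y|p u v s].
  by rewrite !wdeg_mk h1 hL.
by rewrite h2 (linZ (hL _)) wdeg_swap.
Qed.

Lemma multisymD W (F F' : seq E -> W) : multisym F -> multisym F' -> multisym (fun s => F s + F' s).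
Proof.
move=> [h1 h2] [h3 h4]; split=> [p i s c x y|p u v s].
  by rewrite h1 h3 scalerDr addrACA.
by rewrite h2 h4 scalerDr.
Qed.

Lemma multisymZ W c (F : seq E -> W) : multisym F -> multisym (fun s => c *: F s).
Proof. exact: (multisym_comp (L := fun _ x => c *: x) (fun=> @scale_linear K W c)). Qed.

(** The action on letters of a map D of degree n. *)
Definition letter_op (n : int) (D : V -> V) (e : E) : E := mk (deg e + n) (D (lval e)).

Lemma mk_linear W (F : seq E -> W) p s i (U : lmodType K) (f : U -> V) :
  multilin F -> linear f -> linear (fun x => F (p ++ mk i (f x) :: s)).
Proof. by move=> h hf c x y; rewrite hf h. Qed.

Lemma letter_op_linear W (F : seq E -> W) p s i n D :
  multilin F -> linear D -> linear (fun x => F (p ++ letter_op n D (mk i x) :: s)).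
Proof.
move=> h hD; apply: (@mk_linear W F p s (i + n) V (fun x => D (gproj gV i x))) => // c x y.
by rewrite gproj_linear hD.
Qed.

Lemma multisym_dr n D W (F : seq E -> W) : linear D -> multisym F ->
  multisym (dr n (letter_op n D) F).
Proof.
move=> hD [hl hs]; split=> p.
  elim: p F hl {hs} => [|e p IH] F h i s c x y /=.
    rewrite (letter_op_linear [::]) //= (eq_dr deg _ _ _ (fun t => h [::] i t c x y)) /=.
    by rewrite drD drZ !scalerDr !scalerA [_ * c]mulrC addrACA.
  rewrite (h (_ :: p)) (IH _ (multilin_cons e h)) !scalerDr !scalerA [_ * c]mulrC.
  exact: addrACA.
elim: p F hl hs => [|e p IH] F hl h u v s /=.
  rewrite (h [:: ]) (h [::] u (letter_op n D v)) /=.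
  rewrite (eq_dr deg _ _ _ (fun t => h [::] u v t)) /= drZ.
  rewrite !scalerDr !scalerA -!sgnD; sgn_zmod.
by rewrite (h (_ :: p)) (IH _ (multilin_cons e hl) (gsym_cons e h)) scalerDr !scalerA [_ * sgn (n
  * _)]mulrC.
Qed.

Lemma multisym_cop2 W (T : seq E -> seq E -> W) :
  (forall b, multisym (fun a => T a b)) -> (forall a, multisym (T a)) -> multisym (cop2 T).
Proof.
move=> h1 h2; split=> p.
  elim: p T h1 h2 => [|e p IH] T h1 h2 i s c x y /=.
    rewrite (eq_cop2 (T' := fun a b => c *: T (mk i x :: a) b + T (mk i y :: a) b)).
      rewrite cop2D cop2Z (eq_cop2 (T := fun a b => sgn (i * wdeg a) *: T a (mk i (c *: x + y) ::
        b))
        (T' := fun a b => c *: (sgn (i * wdeg a) *: T a (mk i x :: b))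
                          + sgn (i * wdeg a) *: T a (mk i y :: b))).
        by rewrite cop2D cop2Z scalerDr addrACA.
      move=> a b _ _; have [hl _] := h2 a.
      by rewrite (hl [::]) /= scalerDr !scalerA [_ * c]mulrC.
    by move=> a b _ _; exact: (proj1 (h1 b) [::] i a c x y).
  rewrite (IH (fun a b => T (e :: a) b)); last 2 first.
  - by move=> b; exact: (multisym_cons e (h1 b)).
  - by move=> a; apply: h2.
  rewrite (IH (fun a b => sgn (deg e * wdeg a) *: T a (e :: b))); last 2 first.
  - move=> b; apply: (@multisym_comp W W (fun n x => sgn (deg e * n) *: x)) => // n.
    exact: scale_linear.
  - by move=> a; exact: (multisymZ _ (multisym_cons e (h2 a))).
  by rewrite scalerDr addrACA.
elim: p T h1 h2 => [|e p IH] T h1 h2 u v s /=.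
  rewrite scalerDr !addrA -!cop2D -!cop2Z -!cop2D; apply: eq_cop2 => a b _ _.
  have [_ h3] := h1 b; have [_ h4] := h2 a.
  have e1 : T (u :: v :: a) b = sgn (deg u * deg v) *: T (v :: u :: a) b.
    exact: (h3 [::]).
  have e2 : T a (u :: v :: b) = sgn (deg u * deg v) *: T a (v :: u :: b).
    exact: (h4 [::]).
  rewrite e1 e2 !wdeg_cons !scalerDr !scalerA -!sgnD; sgn_zmod.
rewrite (IH (fun a b => T (e :: a) b)); last 2 first.
- by move=> b; exact: (multisym_cons e (h1 b)).
- by move=> a; apply: h2.
rewrite (IH (fun a b => sgn (deg e * wdeg a) *: T a (e :: b))); last 2 first.
- move=> b; apply: (@multisym_comp W W (fun n x => sgn (deg e * n) *: x)) => // n.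
  exact: scale_linear.
- by move=> a; exact: (multisymZ _ (multisym_cons e (h2 a))).
by rewrite scalerDr.
Qed.

Variable b : V -> V -> V.
Hypothesis b_linl : forall y, linear (b ^~ y).
Hypothesis b_linr : forall x, linear (b x).
Hypothesis b_sym : forall i j x y, homog V i x -> homog V j y ->
  b x y = sgn (i * j) *: b y x.

Definition bracket_op (v w : E) : E := mk (deg w + (deg v + 1)) (b (lval v) (lval w)).
Notation qd := (quad_deriv deg bracket_op).
Lemma deg_bracket_op v w : deg (bracket_op v w) = deg w + (deg v + 1). Proof. by []. Qed.

Lemma multisym_qd W (F : seq E -> W) : multisym F -> multisym (qd F).
Proof.
move=> [hl hs]; split=> p.
  elim: p F hl hs => [|e p IH] F h h' i s c x y /=.
    have hd : linear (fun z => dr (i + 1) (bracket_op (mk i z)) F s).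
      apply: dr_family_lin => q e t.
      apply: (@mk_linear W F q t (deg e + (i + 1)) V (fun z => b (gproj gV i z) (lval e))) => //.
      by move=> k z z'; rewrite gproj_linear b_linl.
    rewrite hd (@eq_qd _ _ _ _ deg_bracket_op _ _ (fun t => c *: F (mk i x :: t) + F (mk i y ::
      t))) //.
      by rewrite qdD qdZ // !scalerDr !scalerA [_ * c]mulrC addrACA.
    by move=> t _; apply: (h [::]).
  have [h1 _] : multisym (dr (deg e + 1) (bracket_op e) F).
    by apply: (@multisym_dr _ (b (lval e))).
  rewrite h1 (IH _ (multilin_cons e h) (gsym_cons e h')) !scalerDr !scalerA [_ * c]mulrC.
  exact: addrACA.
elim: p F hl hs => [|e p IH] F h h' u v s /=.
  have e1 : F (bracket_op u v :: s) = sgn (deg u * deg v) *: F (bracket_op v u :: s).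
    rewrite /bracket_op (b_sym (lvalP u) (lvalP v)).
    by rewrite (linZ (h [::] _ s)) /= [deg v + (_ + 1)]addrCA.
  rewrite e1 (@eq_qd _ _ _ _ deg_bracket_op _ _ (fun t => sgn (deg u * deg v) *: F (v :: u :: t)))
    //.
    rewrite qdZ // !scalerDr !scalerA -!sgnD; sgn_zmod.
  by move=> t _; apply: (h' [::]).
have [_ h1] : multisym (dr (deg e + 1) (bracket_op e) F).
  by apply: (@multisym_dr _ (b (lval e))).
by rewrite h1 (IH _ (multilin_cons e h) (gsym_cons e h')) scalerDr !scalerA [_ * sgn (deg e)]mulrC.
Qed.

End SymmetricWordFunctions.

(** * Linear maps on the symmetric algebra *)

Section SymLinear.
Variables (K : fieldType) (V : gspace K) (gV : graded V).
Notation E := (hletter V).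
Notation deg := (@ldeg K V).
Notation wdeg := (word_deg deg).
Notation lvals := (map (@lval K V)).
Implicit Types (s p : seq E) (W : lmodType K).

Lemma wprod_cons e s : wprod (e :: s) = sym_in (lval e) * wprod s.
Proof. exact: sym_prod_cons. Qed.

Lemma wprod_cat p s : wprod (p ++ s) = wprod p * wprod s.
Proof. by rewrite /wprod map_cat sym_prod_cat. Qed.

Lemma sym_slot_linear W (phi : sym_type V -> W) (X Y : sym_type V) :
  linear phi -> linear (fun x => phi (X * (sym_in x * Y))).
Proof.
move=> h c x y; rewrite sym_in_linear mulrDl mulrDr -sym_scaleAl.
by rewrite -sym_scaleAr h.
Qed.

Lemma multisym_wprod W (phi : sym_type V -> W) : linear phi ->
  multisym gV (fun s => phi (wprod s)).
Proof.
move=> h; split=> [p i s c x y|p u v s].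
  rewrite !wprod_cat !wprod_cons /= gproj_linear; exact: sym_slot_linear.
rewrite !wprod_cat !wprod_cons !mulrA -[wprod p * _ * _]mulrA.
rewrite (sym_in_comm (lvalP u) (lvalP v)) -sym_scaleAr -sym_scaleAl (linZ h).
by rewrite !mulrA.
Qed.

(** Products of homogeneous vectors span the symmetric algebra. *)
Lemma eq_on_wprod W (phi psi : sym_type V -> W) : linear phi -> linear psi ->
  (forall s, phi (wprod s) = psi (wprod s)) -> phi =1 psi.
Proof.
move=> hp hq h x.
have P (w : seq V) : forall f g : sym_type V -> W, linear f -> linear g ->
    (forall s, f (wprod s) = g (wprod s)) -> f (sym_prod w) = g (sym_prod w).
  elim: w => [|y w IH] f g hf hg hfg; first exact: (hfg [::]).
  rewrite !sym_prod_cons.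
  have L (k : sym_type V -> W) : linear k -> linear (fun z => k (sym_in z * sym_prod w)).
    by move=> hk c z t; rewrite sym_in_linear mulrDl -sym_scaleAl hk.
  apply: (eq_on_homog gV (L _ hf) (L _ hg)) => n z hz.
  have M (k : sym_type V -> W) : linear k -> linear (fun X => k (sym_in z * X)).
    by move=> hk c X Y; rewrite mulrDr -sym_scaleAr hk.
  apply: (IH _ _ (M _ hf) (M _ hg)) => s.
  by have := hfg (HLetter hz :: s); rewrite !wprod_cons.
rewrite -[x]sym_piK; set a := generic_quotient.repr x.
rewrite [a]malg_span.
have L (k : sym_type V -> W) : linear k -> linear (fun b : {malg K[{fmonom V}]} => k (sym_pi b)).
  by move=> hk c y z; rewrite sym_piD sym_piZ hk.
rewrite (lin_sum (L _ hp)) (lin_sum (L _ hq)); apply: eq_bigr => k _.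
rewrite (linZ (L _ hp)) (linZ (L _ hq)); congr (_ *: _).
by rewrite -[k]fmK sym_pi_word; apply: P.
Qed.

Lemma wprod_homog s : homog (Defs.Sym V) (wdeg s) (wprod s).
Proof.
rewrite -[wprod s]scale1r -[_ *: _]addr0; apply: (@span_ofD _ _ _ 0); last exact: span_of0.
exists [seq (ldeg e, lval e) | e <- s]; split.
- by elim: s => //= e s IH q; rewrite inE => /predU1P[->|/IH//]; apply: lvalP.
- by rewrite big_map.
- by rewrite /wprod /unzip2 -map_comp.
Qed.

Lemma hom_degP (g : gspace K) (gg : graded g) n (phi : Defs.Sym V -> g) : linear phi ->
  hom_deg n phi <-> (forall s, homog g (wdeg s + n) (phi (wprod s))).
Proof.
move=> h; split=> [[_ H] s|H]; first by apply: H; apply: wprod_homog.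
split=> // i x; elim=> [|_ c {}x y [s [hs <- ->]] _ IH].
  by rewrite (lin0 h); apply: homog0.
rewrite h; apply: (homog_lin gg) => //.
have [t [<- <-]] : exists t : seq E, lvals t = unzip2 s /\
    wdeg t = \sum_(q <- s) q.1.
  elim: s hs {IH} => [|q s IHs] hs; first by exists [::]; rewrite wdeg_nil big_nil.
  have [|t [e1 e2]] := IHs; first by move=> q' hq'; apply: hs; rewrite inE hq' orbT.
  exists (HLetter (hs q (mem_head _ _)) :: t); rewrite wdeg_cons big_cons /= e1.
  by rewrite e2.
exact: H.
Qed.

End SymLinear.

(** * Cochains as functions of words *)

Section SpanFacts.
Variables (K : fieldType) (M : lmodType K) (A : int -> M -> Prop).

Lemma gsum_val_span (x : gsum_type A) : span_of A (gsum_val x).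
Proof. by case: x => x hx; apply/asboolP. Qed.

Definition gsum_mk n x (h : A n x) : gsum_type A.
Proof.
apply: (@GSum K M A x); apply/asboolP.
rewrite -[x]scale1r -[1 *: x]addr0; apply: span_ofD h _; exact: span_of0.
Defined.

Lemma gsum_inj (x y : gsum_type A) : gsum_val x = gsum_val y -> x = y.
Proof. exact: val_inj. Qed.

Lemma gsum_spanned (x : gsum_type A) : span_of (homog (gsum A)) x.
Proof.
case: x => x hx; have /asboolP h := hx.
elim: h hx => [|n c y z hy hz IH] hx.
  have -> : GSum hx = 0 by exact: gsum_inj.
  exact: span_of0.
have hz' : z \in span_pred A by apply/asboolP.
have -> : GSum hx = c *: gsum_mk hy + GSum hz' by exact: gsum_inj.
exact: (@span_ofD _ _ _ n).
Qed.
End SpanFacts.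

Lemma span_hom_linear (K : fieldType) (V W : gspace K) (f : V -> W) : span_of (@hom_deg K V W) f
  -> linear f.
Proof.
elim=> [|n c x y [hx _] _ hy]; first by move=> c x y; rewrite /= scaler0 addr0.
move=> k u v; rewrite -[LHS]/(c *: x (k *: u + v) + y (k *: u + v)) hx hy.
rewrite -[X in _ = k *: X + _]/(c *: x u + y u) -[X in _ = _ + X]/(c *: x v + y v).
by rewrite !scalerDr !scalerA [c * k]mulrC addrACA.
Qed.
Section CochainFacts.
Variables (K : fieldType) (g h : sgLa K).
Notation C := (cochain g h).
Notation E := (hletter h).
Notation deg := (@ldeg K h).
Notation wdeg := (word_deg deg).

Lemma sgLa_graded (l : sgLa K) : graded l.
Proof. by case: (sgLaP l). Qed.

Definition cword (c : C) (s : seq E) : g := gsum_val c (wprod s).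

Lemma cevE c s : cev c (map (@lval K h) s) = cword c s.
Proof. by []. Qed.

Lemma cochain_linear (c : C) : linear (gsum_val c).
Proof. exact/span_hom_linear/gsum_val_span. Qed.

Lemma cochain_eq (c c' : C) : cword c =1 cword c' -> c = c'.
Proof.
move=> e; apply: gsum_inj; apply/funext.
by apply: (eq_on_wprod (sgLa_graded h)) => //; apply: cochain_linear.
Qed.

Lemma cochain_homogP n (c : C) :
  homog C n c <-> forall s, homog g (wdeg s + n) (cword c s).
Proof. exact (hom_degP (sgLa_graded g) n (cochain_linear c)). Qed.

Lemma cwD k (c c' : C) s : cword (k *: c + c') s = k *: cword c s + cword c' s.
Proof. by []. Qed.

Lemma cword_linear s : linear (cword ^~ s).
Proof. by move=> k c c'. Qed.

Lemma cword_multisym c : multisym (sgLa_graded h) (cword c).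
Proof. exact/multisym_wprod/cochain_linear. Qed.

Lemma cochain_exists n (F : seq E -> g) : multisym (sgLa_graded h) F ->
  (forall s, homog g (wdeg s + n) (F s)) ->
  exists2 c : C, homog C n c & cword c =1 F.
Proof.
move=> [h1 h2] hF; have [phi hp e] := Sym_ext h1 h2.
have hd : hom_deg (V := Defs.Sym h) (W := g) n phi.
  by apply/(hom_degP (sgLa_graded g) n hp) => s; rewrite e.
by exists (gsum_mk hd).
Qed.

(** Components of different degrees are independent, because their values on a
    word lie in different degrees of g. *)
Lemma cochain_graded : graded C.
Proof.
have gg := sgLa_graded g; split.
- by move=> n; apply/cochain_homogP => s; apply: homog0.
- move=> n c x y /cochain_homogP hx /cochain_homogP hy.
  by apply/cochain_homogP => s; rewrite cwD; apply: homog_lin.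
- exact: gsum_spanned.
- move=> s x us hx sx n ns; apply: cochain_eq => w.
  have [_ _ _ ind] := gg.
  have := ind [seq wdeg w + k | k <- s] (fun k => cword (x (k - wdeg w)) w).
  move=> /(_ _ _ _ (wdeg w + n)) H.
  have := H _ _ _ _; rewrite [wdeg w + n]addrC addrK => -> //.
  + by rewrite map_inj_uniq //; apply: addrI.
  + move=> k; have /cochain_homogP/(_ w) := hx (k - wdeg w).
    by rewrite addrC subrK.
  + rewrite big_map (eq_bigr (fun k => cword (x k) w)); last first.
      by move=> k _; rewrite addrC addKr.
    by rewrite -(lin_sum (cword_linear w)) sx.
  + by apply/mapP; exists n => //; rewrite addrC.
Qed.
End CochainFacts.

Section SuspGraded.
Variables (K : fieldType) (V : gspace K).
Lemma susp_graded : graded V -> graded (susp V).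
Proof.
case=> h0 h1 h2 h3; split.
- by move=> n; apply: h0.
- by move=> n c x y; apply: h1.
- move=> x; elim: (h2 x) => [|n c y z hy _ IH]; first exact: span_of0.
  by apply: (@span_ofD _ _ _ (n + 1)) => //; rewrite /homog /= addrK.
- move=> s x us hx sx n ns.
  have H := h3 [seq k - 1 | k <- s] (fun k => x (k + 1)).
  have := H _ _ _ (n - 1); rewrite subrK; apply.
  + by rewrite map_inj_uniq //; apply: addIr.
  + by move=> k; have := hx (k + 1); rewrite /homog /= addrK.
  + by rewrite big_map (eq_bigr x) // => k _; rewrite subrK.
  + by apply/mapP; exists n.
Qed.
End SuspGraded.

(** * The differential graded Lie algebra *)

Section Main.
Variables (K : fieldType) (g h : sgLa K) (rho : g -> Der h).
Hypothesis rho_action : is_action rho.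
Notation C := (cochain g h).
Notation E := (hletter h).
Notation deg := (@ldeg K h).
Notation wdeg := (word_deg deg).
Notation gh := (sgLa_graded h).
Notation gg := (sgLa_graded g).
Notation gC := (@cochain_graded K g h).
Notation lvals := (map (@lval K h)).
Notation multisym := (multisym gh).
Implicit Types (s p : seq E) (e u v : E).

Notation "[sg x , y ]" := (sgLa_bracket x y)
  (at level 0, x, y at level 9, format "[sg  x ,  y ]").

Lemma sg_linl (l : sgLa K) (y : l) : linear (fun x : l => [sg x, y]).
Proof. by case: (sgLaP l) => _ [_ h2 _] _ _; apply: h2. Qed.
Lemma sg_linr (l : sgLa K) (x : l) : linear (fun y : l => [sg x, y]).
Proof. by case: (sgLaP l) => _ [h2 _ _] _ _; apply: h2. Qed.
Lemma sg_homog (l : sgLa K) i j (x y : l) : homog l i x -> homog l j y ->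
  homog l (i + j + 1) [sg x, y].
Proof. by case: (sgLaP l) => _ [_ _ h2] _ _; apply: h2. Qed.
Lemma sg_sym (l : sgLa K) i j (x y : l) : homog l i x -> homog l j y ->
  [sg x, y] = sgn (i * j) *: [sg y, x].
Proof. by case: (sgLaP l) => _ _ h2 _; apply: h2. Qed.
Lemma sg_jac (l : sgLa K) i j k (x y z : l) :
  homog l i x -> homog l j y -> homog l k z ->
  [sg x, [sg y, z]] = sgn (i + 1) *: [sg [sg x, y], z]
    + sgn ((i + 1) * (j + 1)) *: [sg y, [sg x, z]].
Proof. by case: (sgLaP l) => _ _ _ h2; apply: h2. Qed.

(** The suspension of g, with its ordinary graded Lie bracket. *)
Definition shomog (i : int) (x : g) : Prop := homog g (i - 1) x.
Definition sbracket (i : int) (x y : g) : g := sgn i *: [sg x, y].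

Lemma shomog0 i : shomog i 0. Proof. exact: homog0 gg _. Qed.
Lemma shomogD i (c : K) x y : shomog i x -> shomog i y -> shomog i (c *: x + y).
Proof. exact: homog_lin gg _ _ _ _. Qed.
Lemma shomog_bracket i j x y : shomog i x -> shomog j y -> shomog (i + j) (sbracket i x y).
Proof.
move=> hx hy; apply: (homogZ gg); have := sg_homog hx hy.
by have -> : i - 1 + (j - 1) + 1 = i + j - 1 by zmod.
Qed.
Lemma sbracket_linr i x : linear (sbracket i x).
Proof. by move=> c y z; rewrite /sbracket sg_linr scalerDr !scalerA mulrC. Qed.
Lemma sbracket_linl i y : linear (sbracket i ^~ y).
Proof. by move=> c x z; rewrite /sbracket sg_linl scalerDr !scalerA mulrC. Qed.
Lemma sbracketC i j x y : shomog i x -> shomog j y -> sbracket i x y = - (sgn (i * j) *: sbracket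
  j y x).
Proof.
move=> hx hy; rewrite /sbracket (sg_sym hx hy) !scalerA -!sgnD -scaleN1r scalerA.
by rewrite -(sgn1 K) -sgnD; congr (_ *: _); sgn_eq.
Qed.
(** With i = |x| + 1, the sign (-1)^(|x| + 1) of the given Jacobi identity is
    absorbed by those in [sbracket]. *)
Lemma sbracketJ i j k x y z : shomog i x -> shomog j y -> shomog k z ->
  sbracket i x (sbracket j y z) = sbracket (i + j) (sbracket i x y) z + sgn (i * j) *: sbracket j
    y (sbracket i x z).
Proof.
move=> hx hy hz; rewrite /sbracket (linZ (sg_linl _)) !(linZ (sg_linr _)).
rewrite (sg_jac hx hy hz) !subrK !scalerDr !scalerA -!sgnD.
by congr (_ *: _ + _ *: _); sgn_eq.
Qed.

Definition act (x : g) : h -> h := der_fun (rho x).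

Lemma act_linl (v : h) : linear (act ^~ v).
Proof.
case: rho_action => -[hl _] _ c x y; rewrite /act hl; exact: erefl.
Qed.

Lemma act_linr x : linear (act x).
Proof.
suff H (f : h -> h) : span_of (@der_deg K h) f -> linear f.
  exact/H/gsum_val_span.
elim=> [|n c u v [[hu _] _] _ hv]; first by move=> c y z; rewrite /= scaler0 addr0.
move=> k y z; rewrite -[LHS]/(c *: u (k *: y + z) + v (k *: y + z)) hu hv.
rewrite -[X in _ = k *: X + _]/(c *: u y + v y) -[X in _ = _ + X]/(c *: u z + v z).
by rewrite !scalerDr !scalerA [c * k]mulrC addrACA.
Qed.

Lemma act_der i x : shomog i x -> der_deg i (act x).
Proof.
move=> hx; case: rho_action => -[_ /(_ _ _ hx) H] _; move: H.
by rewrite /= addr0 subrK.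
Qed.

Lemma act_homog i j x y : shomog i x -> homog h j y -> homog h (j + i) (act x y).
Proof. by move=> /act_der[[_ H] _]; apply: H. Qed.

Definition act_letter (i : int) (x : g) : E -> E := letter_op gh i (act x).
Definition br_letter : E -> E -> E := bracket_op gh (@sgLa_bracket K h).

Lemma deg_act_letter i x e : deg (act_letter i x e) = deg e + i. Proof. by []. Qed.
Lemma deg_br_letter u v : deg (br_letter u v) = deg v + (deg u + 1). Proof. by []. Qed.

Lemma lval_act_letter i x e : shomog i x -> lval (act_letter i x e) = act x (lval e).
Proof. by move=> hx; apply: lval_mk; apply: act_homog hx (lvalP e). Qed.

Lemma lval_br_letter u v : lval (br_letter u v) = [sg (lval u), (lval v)].
Proof.
apply: lval_mk; have := sg_homog (lvalP u) (lvalP v).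
by rewrite addrAC addrC.
Qed.

(** f as a linear function of one letter, in a given context. *)
Definition slot (W : lmodType K) (f : sym_type h -> W) (p s : seq E) (x : h) : W :=
  f (wprod p * (sym_in x * wprod s)).

Lemma cword_slot (c : C) p e s :
  cword c (p ++ e :: s) = slot (gsum_val c) p s (lval e).
Proof. by rewrite /cword /slot wprod_cat wprod_cons. Qed.

Lemma slot_linear (c : C) p s : linear (slot (gsum_val c) p s).
Proof. exact/sym_slot_linear/cochain_linear. Qed.

Lemma cword_ops_linear (c : C) : ops_linear act_letter (cword c).
Proof.
move=> p i e s k x y; rewrite !cword_slot /=.
by rewrite (act_linl (lval e)) gproj_linear slot_linear.
Qed.

(** This is where rho preserves brackets: the sign in the bracket of s^-1 Der(h)
    is that of [sbracket]. *)
Lemma cword_ops_comm (c : C) : ops_comm shomog sbracket act_letter (cword c).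
Proof.
move=> i j x y hx hy p e s; rewrite !cword_slot !lval_act_letter //; last exact: shomog_bracket.
case: rho_action => _ /(_ _ _ _ _ hx hy) H.
have L := slot_linear c p s.
rewrite -(linZ L) -(linB L); congr (slot _ _ _ _).
rewrite /sbracket (linZ (act_linl _)) /act H /sder_bracket /gcomm !subrK scalerA.
by rewrite -[(-1) ^ i]/(sgn i) -sgnD (@eq_sgn _ (i + i) 0) ?sgn0 ?scale1r // parD addbb.
Qed.

Lemma cword_ops_der (c : C) : ops_der deg shomog act_letter br_letter (cword c).
Proof.
move=> i x hx p v w s; rewrite !cword_slot !(lval_act_letter _ hx) !lval_br_letter
  !(lval_act_letter _ hx).
have L := slot_linear c p s; rewrite -!(linZ L) -(linD L); congr (slot _ _ _ _).
by case: (act_der hx) => _ H; apply: H (lvalP v) (lvalP w).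
Qed.

Lemma cword_jacobi (c : C) p u v w s :
  cword c (p ++ br_letter u (br_letter v w) :: s) =
      sgn (deg u + 1) *: cword c (p ++ br_letter (br_letter u v) w :: s)
      + sgn ((deg u + 1) * (deg v + 1)) *: cword c (p ++ br_letter v (br_letter u w) :: s).
Proof.
rewrite !cword_slot !lval_br_letter (sg_jac (lvalP u) (lvalP v) (lvalP w)).
have L := slot_linear c p s; by rewrite (linD L) !(linZ L).
Qed.

Notation wB := (word_bracket deg sbracket act_letter).
Notation wd := (word_diff deg br_letter).
Notation vd := (vect_deriv deg act_letter).
Notation cv := (conv_bracket deg sbracket).
Notation cdeg := (cdeg deg shomog).

Lemma cword_cdeg n (c : C) : homog C n c -> cdeg (n + 1) (cword c).
Proof. by move=> /cochain_homogP H s; rewrite /shomog addrA addrK. Qed.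

Lemma multisym_vd N (f : seq E -> g) (W : lmodType K) (phi : seq E -> W) :
  multisym f -> multisym phi -> multisym (vd N f phi).
Proof.
move=> hf hp; apply: multisym_cop2 => [b|a]; last first.
  by apply: multisym_dr => //; apply: act_linr.
apply: (@multisym_comp _ _ _ _ _ (fun n x => letter_deriv deg (n + N) (act_letter (n + N) x) phi
  b)) => // n.
apply: dr_family_lin => p e s.
apply: (@mk_linear _ _ _ _ _ p s (deg e + (n + N)) _ (fun x => act x (lval e))).
  by case: hp.
exact: act_linl.
Qed.

Lemma multisym_cv M N (f f' : seq E -> g) : multisym f -> multisym f' -> multisym (cv M N f f').
Proof.
move=> hf hf'; apply: multisym_cop2 => [b|a].
  apply: (@multisym_comp _ _ _ _ _ (fun n x => sgn (N * n) *: sbracket (n + M) x (f' b))) => //.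
  by move=> n c x y; rewrite sbracket_linl scalerDr !scalerA [_ * c]mulrC.
apply: (@multisym_comp _ _ _ _ _ (fun _ y => sgn (N * wdeg a) *: sbracket (wdeg a + M) (f a) y))
  => //.
by move=> n c x y; rewrite sbracket_linr scalerDr !scalerA [_ * c]mulrC.
Qed.

Lemma multisym_wB M N (f f' : seq E -> g) : multisym f -> multisym f' -> multisym (wB M N f f').
Proof.
move=> hf hf'; apply: multisymD; last exact: multisym_cv.
apply: multisymD; first exact: multisym_vd.
apply: (@multisym_comp _ _ _ _ _ (fun _ x => - (sgn (M * N) *: x))); last exact: multisym_vd.
by move=> _ c x y; rewrite !scalerDr opprD !scalerN !scalerA [_ * c]mulrC.
Qed.

Lemma multisym_wd lam M (f : seq E -> g) : multisym f -> multisym (wd lam M f).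
Proof.
move=> hf; apply: multisymZ; apply: multisym_qd => //; [exact: sg_linl|exact: sg_linr|].
exact: sg_sym.
Qed.

Lemma gsym_cword (c : C) : gsym deg (cword c).
Proof. by case: (cword_multisym c). Qed.

Lemma cev_slot (c : C) x s : cev c (x :: lvals s) = slot (gsum_val c) [::] s x.
Proof.
rewrite /cev /slot sym_prod_cons; congr (gsum_val c _).
by rewrite /wprod /sym_prod big_nil mul1r.
Qed.

Lemma sum_from1 (U : nmodType) (p : nat) (F : nat -> U) :
  \sum_(1 <= k < p.+2) F k = \sum_(l < p.+1) F l.+1.
Proof. by rewrite big_add1 big_mkord. Qed.

Section Formulas.
Variables (p : nat) (v : 'I_p -> h) (a : 'I_p -> int).
Hypothesis va : forall i, homog h (a i) (v i).
Definition letter_at i : E := HLetter (va i).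
Definition word_of := [seq letter_at i | i <- enum 'I_p].

Lemma tup_word_of : tup v = lvals word_of.
Proof. by rewrite /tup /word_of -map_comp. Qed.

(** lambda is moved out of the bracket by linearity, and (-1)^(n + 1) is the
    sign in [word_diff]. *)
Lemma diff_rhs lambda n (f : C) :
  \sum_(i < p) \sum_(j < p | (i < j)%N)
    (-1) ^ (n + 1 + a i * (\sum_(k < p | (k < i)%N) a k)
            + a j * (\sum_(k < p | (k < j)%N) a k) + a i * a j)
    *: cev f ((lambda *: sgLa_bracket (v i) (v j))
              :: [seq v k | k <- enum 'I_p & (k != i) && (k != j)])
  = wd lambda (n + 1) (cword f) word_of.
Proof.
rewrite /word_diff -(qd_sum deg_br_letter letter_at (gsym_cword f)) scaler_sumr.
apply: eq_bigr => i _; rewrite scaler_sumr; apply: eq_bigr => j _.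
have -> : [seq v k | k <- enum 'I_p & (k != i) && (k != j)] =
    lvals [seq letter_at k | k <- enum 'I_p & (k != i) && (k != j)] by rewrite -map_comp.
rewrite cev_slot (linZ (slot_linear f _ _)) (cword_slot f [::]) lval_br_letter !scalerA.
congr (_ *: _); rewrite -[(-1) ^ _]/(sgn _) mulrAC -sgnD; congr (sgn _ * _).
by rewrite !addrA.
Qed.

Lemma nth_lvals (x0 : E) (s : seq E) i : lval x0 = 0 ->
  nth 0 (lvals s) i = lval (nth x0 s i).
Proof.
move=> e; case: (ltnP i (size s)) => hi; first by rewrite (nth_map x0).
by rewrite !nth_default ?size_map.
Qed.

(** The three sums are f R_g, g R_f and f # g on the word; in the last one the
    given sign n |a| + m + 1 agrees with (n + 1) |a| + (|a| + m + 1), the signs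
    of the convolution and of [sbracket]. *)
Lemma bracket_rhs m n (f f' : C) : homog C m f -> homog C n f' ->
  let w (s : 'S_p) := tup (fun i => v (s i)) in
  - (\sum_(1 <= k < p.+2) let l := (p.+1 - k)%N in
      \sum_(s : 'S_p | shuffle [:: l%:Z; 1; p%:Z - l%:Z - 1] s)
        koszul K s a *:
        cev f (der_fun (rho (cev f' (take l (w s)))) (nth 0 (w s) l)
               :: drop l.+1 (w s)))
  + (-1) ^ ((m + 1) * (n + 1)) *:
    (\sum_(1 <= k < p.+2)
      \sum_(s : 'S_p | shuffle [:: k%:Z - 1; 1; p%:Z - k%:Z] s)
        koszul K s a *:
        cev f' (der_fun (rho (cev f (take k.-1 (w s)))) (nth 0 (w s) k.-1)
                :: drop k (w s)))
  - (\sum_(1 <= k < p.+2) let l := (p.+1 - k)%N in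
      \sum_(s : 'S_p | shuffle [:: k%:Z - 1; l%:Z] s)
        ((-1) ^ (n * (\sum_(i < p | (i < k.-1)%N) a (s i)) + m + 1)
         * koszul K s a) *:
        sgLa_bracket (cev f (take k.-1 (w s))) (cev f' (drop k.-1 (w s))))
  = - wB (m + 1) (n + 1) (cword f) (cword f') word_of.
Proof.
move=> hf hf' w.
have wE (s : 'S_p) : w s = lvals [seq letter_at (s i) | i <- enum 'I_p].
  by rewrite /w /tup -map_comp.
pose x0 : E := HLetter (homog0 gh 0).
(* The first two sums have the same form, with the roles of f and f'
   exchanged. *)
have actE M (c c' : C) : homog C M c ->
  \sum_(l < p.+1) \sum_(s : 'S_p | shuffle [:: l%:Z; 1; p%:Z - l%:Z - 1] s)
     koszul K s a *: cev c' (der_fun (rho (cev c (take l (w s)))) (nth 0 (w s) l)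
        :: drop l.+1 (w s))
  = vd (M + 1) (cword c) (cword c') word_of.
  move=> hc; rewrite /vect_deriv.
  transitivity (coprod2 deg (fun x => coprod2 deg (fun y z => if y is [:: e] then
     cev c' (act (cword c x) (lval e) :: lvals z) else 0)) word_of); last first.
    apply: eq_cop2 => x y _ _; rewrite -dr_front //; last exact: gsym_cword.
    apply: eq_cop2 => -[|e [|? ?]] z _ _ //.
    by rewrite cev_slot (cword_slot c' [::]) lval_act_letter //; apply: cword_cdeg.
  rewrite -(sum_3blocks deg letter_at (fun x e z => cev c' (act (cword c x) (lval e) :: lvals z))
    x0).
  apply: eq_bigr => l _; apply: eq_bigr => s _; rewrite wE /=.
  by rewrite (nth_lvals (x0 := x0)) // -map_take -map_drop.
rewrite wBE !opprD opprK; congr (- _ + _ *: _ - _).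
- rewrite sum_from1.
  (* l = p + 1 - k runs through the same values as k - 1, in reverse order. *)
  by rewrite -(actE _ _ _ hf') [RHS](reindex_inj rev_ord_inj).
- rewrite sum_from1 -(actE _ _ _ hf); apply: eq_bigr => l _.
  by apply: eq_bigl => s; congr shuffle; congr [:: _; _; _]; lia.
rewrite sum_from1 /conv_bracket.
rewrite -(sum_2blocks deg letter_at (fun x y => sgn ((n + 1) * wdeg x) *: sbracket (wdeg x + (m +
  1)) (cword f x) (cword f' y))).
apply: eq_bigr => l _; rewrite subSS.
apply: eq_big => [s|s _].
  by congr shuffle; congr [:: _; _]; lia.
rewrite wE /= -map_take -map_drop !cevE /sbracket !scalerA.
congr (_ *: _); rewrite -[RHS]mulrA [RHS]mulrC -sgnD; congr (_ * _).
rewrite -[(-1) ^ _]/(sgn _) /word_deg (@sum_take_ord _ _ _ _ (fun i => a (s i))) //.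
by sgn_eq.
Qed.
End Formulas.

Lemma hletter_eta (e : E) (H : homog h (ldeg e) (lval e)) : e = HLetter H.
Proof. by case: e H => i x hx H; congr HLetter; apply: Prop_irrelevance. Qed.

Lemma word_of_tuple s : s = [seq tnth (in_tuple s) i | i <- enum 'I_(size s)].
Proof. by rewrite map_tnth_enum. Qed.

Definition diff_on_words lam (d : C -> C) := forall n f, homog C n f ->
  cword (d f) =1 wd lam (n + 1) (cword f).

Definition bracket_on_words (B : C -> C -> C) := forall m n f f',
  homog C m f -> homog C n f' ->
  cword (B f f') =1 (fun s => - wB (m + 1) (n + 1) (cword f) (cword f') s).

(** Every word is the word of its entries, so the formula for families of
    vectors is one for words. *)
Lemma diff_formulaP lam d : diff_formula lam d <-> diff_on_words lam d.
Proof.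
split=> H n f hf => [s|p v a va]; last first.
  by rewrite (diff_rhs va) (tup_word_of va) cevE (H _ _ hf).
pose e := tnth (in_tuple s).
have ve i : homog h (ldeg (e i)) (lval (e i)) by apply: lvalP.
have sE : s = word_of ve.
  by rewrite [LHS]word_of_tuple; apply: eq_map => i; apply: hletter_eta.
have := H n f hf _ _ _ ve.
by rewrite (diff_rhs ve) (tup_word_of ve) cevE -sE.
Qed.

Lemma bracket_formulaP B : bracket_formula rho B <-> bracket_on_words B.
Proof.
split=> H m n f f' hf hf' => [s|p v a va w]; last first.
  by rewrite (bracket_rhs va hf hf') (tup_word_of va) cevE (H _ _ _ _ hf hf').
pose e := tnth (in_tuple s).
have ve i : homog h (ldeg (e i)) (lval (e i)) by apply: lvalP.
have sE : s = word_of ve.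
  by rewrite [LHS]word_of_tuple; apply: eq_map => i; apply: hletter_eta.
have := etrans (H m n f f' hf hf' _ _ _ ve) (bracket_rhs ve hf hf').
by rewrite (tup_word_of ve) cevE -sE.
Qed.

Lemma wd_linear lam n k (f f' : C) s :
  wd lam n (cword (k *: f + f')) s = k *: wd lam n (cword f) s + wd lam n (cword f') s.
Proof.
rewrite /word_diff (eq_qd deg_br_letter (psi := fun t => k *: cword f t + cword f' t)) //.
by rewrite qdD qdZ scalerDr !scalerA [k * _]mulrC.
Qed.

(** The values on homogeneous cochains exist by [cochain_exists] and depend
    linearly on the cochain; then they are extended linearly. *)
Lemma exists_diff lam : exists d : C -> C, is_cochain_diff lam d.
Proof.
have ex (q : int * C) : exists c : C, homog C q.1 q.2 ->
    homog C (q.1 + 1) c /\ cword c =1 wd lam (q.1 + 1) (cword q.2).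
  case: q => n f /=; have [hf|nf] := pselect (homog C n f); last by exists 0.
  have hd s : homog g (wdeg s + (n + 1)) (wd lam (n + 1) (cword f) s).
    apply: (homogZ gg); have := cdeg_qd shomog0 shomogD deg_br_letter (cword_cdeg hf) s.
    by rewrite /shomog addrA addrK.
  by have [c hc e] := cochain_exists (multisym_wd lam (n + 1) (cword_multisym f)) hd; exists c.
have [D hD] := choice ex.
have lD : homog_linear D.
  move=> n k x y hx hy; apply: cochain_eq => s; rewrite cwD.
  have hxy := homog_lin gC k hx hy.
  by rewrite !(proj2 (hD (n, _) _)) //= wd_linear.
have dE n f : homog C n f -> graded_ext gC D f = D (n, f) by apply: graded_ext_homog.
exists (graded_ext gC D); split; last first.
  by apply/diff_formulaP => n f hf s; rewrite (dE n) // (proj2 (hD (n, f) hf)).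
split; first exact: graded_ext_linear.
by move=> n f hf; rewrite (dE n) //; case: (hD (n, f) hf).
Qed.

Lemma diff_unique lam (d d' : C -> C) : is_cochain_diff lam d -> is_cochain_diff lam d' -> d = d'.
Proof.
move=> [[l1 _] /diff_formulaP h1] [[l2 _] /diff_formulaP h2].
apply/funext/(eq_on_homog gC l1 l2) => n f hf; apply: cochain_eq => s.
by rewrite (h1 _ _ hf) (h2 _ _ hf).
Qed.

(** As for the differential, with [graded_ext] used in one argument and then in
    the other. *)
Lemma exists_bracket : exists B : C -> C -> C, is_cochain_bracket rho B.
Proof.
have ex (q : (int * C) * (int * C)) : exists c : C,
    homog C q.1.1 q.1.2 -> homog C q.2.1 q.2.2 ->
    homog C (q.1.1 + q.2.1 + 1) c /\ cword c =1
      (fun s => - wB (q.1.1 + 1) (q.2.1 + 1) (cword q.1.2) (cword q.2.2) s).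
  case: q => [[m f] [n f']] /=.
  have [hf|nf] := pselect (homog C m f); last by exists 0.
  have [hf'|nf] := pselect (homog C n f'); last by exists 0.
  have hd s : homog g (wdeg s + (m + n + 1)) (- wB (m + 1) (n + 1) (cword f) (cword f') s).
    rewrite -scaleN1r; apply: (homogZ gg).
    have := cdeg_wB shomog0 shomogD shomog_bracket deg_act_letter (cword_cdeg hf) (cword_cdeg hf')
      s.
    rewrite /shomog; have -> // : wdeg s + (m + 1 + (n + 1)) - 1 = wdeg s + (m + n + 1) by zmod.
  have ws : multisym (fun s => - wB (m + 1) (n + 1) (cword f) (cword f') s).
    have := multisymZ (-1) (multisym_wB (m + 1) (n + 1) (cword_multisym f) (cword_multisym f')).
    by congr multisym; apply/funext => s; rewrite scaleN1r.
  by have [c hc e] := cochain_exists ws hd; exists c.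
have [D hD] := choice ex.
have l2 (p : int * C) : homog C p.1 p.2 -> homog_linear (fun q => D (p, q)).
  case: p => m f hf n k x y hx hy; apply: cochain_eq => s; rewrite cwD.
  have hxy := homog_lin gC k hx hy.
  rewrite !(proj2 (hD ((m, f), (n, _)) _ _)) //=.
  rewrite (wB_linr _ sbracket_linr _ _ _ _ _ _ (cword_ops_linear f)).
  by rewrite scalerN opprD.
have l1 f' : homog_linear (fun p : int * C => graded_ext gC (fun q => D (p, q)) f').
  move=> n k x y hx hy; have hxy := homog_lin gC k hx hy.
  rewrite /graded_ext scaler_sumr -big_split /= big_seq [RHS]big_seq.
  apply: eq_bigr => -[m z] hq; have hz : homog C m z := @homog_dec_homog K C gC f' (m, z) hq;
    apply: cochain_eq => s; rewrite cwD.
  rewrite !(proj2 (hD ((n, _), (m, z)) _ _)) //=.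
  rewrite (wB_linl _ sbracket_linl _ _ _ _ _ _ (cword_ops_linear z)).
  by rewrite scalerN opprD.
pose B f f' := graded_ext gC (fun p : int * C => graded_ext gC (fun q => D (p, q)) f') f.
have BE m n f f' : homog C m f -> homog C n f' -> B f f' = D ((m, f), (n, f')).
  move=> hf hf'; rewrite /B (graded_ext_homog gC (l1 f') hf) (graded_ext_homog gC (l2 (m, f) hf)
    hf') //.
exists B; split; last first.
  apply/bracket_formulaP => m n f f' hf hf' s; rewrite (BE m n) //.
  by rewrite (proj2 (hD ((m, f), (n, f')) _ _)).
split=> [f c x y|f' |m n f f' hf hf'].
- rewrite /B /graded_ext scaler_sumr -big_split /= big_seq [RHS]big_seq.
  apply: eq_bigr => p hp; exact: (graded_ext_linear gC (l2 p (@homog_dec_homog K C gC f p hp))).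
- exact: graded_ext_linear (l1 f').
- by rewrite (BE m n) //; case: (hD ((m, f), (n, f')) hf hf').
Qed.

Lemma bracket_unique (B B' : C -> C -> C) :
  is_cochain_bracket rho B -> is_cochain_bracket rho B' -> B = B'.
Proof.
move=> [[r1 l1 _] /bracket_formulaP h1] [[r2 l2 _] /bracket_formulaP h2].
apply/funext => f; apply/funext => f'.
apply: (eq_on_homog gC (r1 f) (r2 f)) => n {}f' hf'.
apply: (eq_on_homog gC (l1 f') (l2 f')) => m {}f hf.
by apply: cochain_eq => s; rewrite (h1 _ _ _ _ hf hf') (h2 _ _ _ _ hf hf').
Qed.

Lemma cochain_dgLa lam (d : C -> C) (B : C -> C -> C) :
  is_cochain_diff lam d -> is_cochain_bracket rho B ->
  is_dgLa (L := susp C) B d.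
Proof.
move=> [[dl dh] /diff_formulaP dE] [[Br Bl Bh] /bracket_formulaP BE].
have cB i j x y : homog (susp C) i x -> homog (susp C) j y ->
    cword (B x y) =1 fun s => - wB i j (cword x) (cword y) s.
  by move=> hx hy s; rewrite (BE _ _ _ _ hx hy) !subrK.
have cd i x : homog (susp C) i x -> cword (d x) =1 wd lam i (cword x).
  by move=> hx s; rewrite (dE _ _ hx) subrK.
have hg i x : homog (susp C) i x -> cdeg i (cword x).
  by move=> hx; have := cword_cdeg hx; rewrite subrK.
have hB i j x y : homog (susp C) i x -> homog (susp C) j y ->
    homog (susp C) (i + j) (B x y).
  move=> hx hy; have := Bh _ _ _ _ hx hy; rewrite /homog /=.
  by have -> : i - 1 + (j - 1) + 1 = i + j - 1 by zmod.
have hd i x : homog (susp C) i x -> homog (susp C) (i + 1) (d x).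
  by move=> hx; have := dh _ _ hx; rewrite /homog /= addrAC.
have wNr i j (k : C) (F : seq E -> g) s :
    wB i j (cword k) (fun t => - F t) s = - wB i j (cword k) F s.
  rewrite -scaleN1r -(wB_Zr _ sbracket_linr _ _ _ _ _ (cword_ops_linear k)).
  by apply: eq_wB => // t; rewrite scaleN1r.
have wNl i j (k : C) (F : seq E -> g) s :
    wB i j (fun t => - F t) (cword k) s = - wB i j F (cword k) s.
  rewrite -scaleN1r -(wB_Zl _ sbracket_linl _ _ _ _ _ (cword_ops_linear k)).
  by apply: eq_wB => // t; rewrite scaleN1r.
split.
- exact/susp_graded/gC.
- by split=> // i j x y hx hy; rewrite addr0; apply: hB.
- by split.
split.
- move=> i j x y hx hy; apply: cochain_eq => s.
  rewrite (linN (cword_linear s)) (linZ (cword_linear s)) (cB _ _ _ _ hx hy) (cB _ _ _ _ hy hx).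
  by rewrite (wBC sbracketC _ (hg _ _ hx) (hg _ _ hy)) scalerN !opprK.
- move=> i j k x y z hx hy hz; apply: cochain_eq => s.
  rewrite (linD (cword_linear s)) (linZ (cword_linear s)).
  rewrite (cB _ _ _ _ hx (hB _ _ _ _ hy hz)) (cB _ _ _ _ (hB _ _ _ _ hx hy) hz).
  rewrite (cB _ _ _ _ hy (hB _ _ _ _ hx hz)).
  rewrite (eq_wB _ _ _ _ _ _ (fun=> erefl) (cB _ _ _ _ hy hz)) wNr.
  rewrite (eq_wB _ _ _ _ _ _ (cB _ _ _ _ hx hy) (fun=> erefl)) wNl.
  rewrite (eq_wB _ _ _ _ _ _ (fun=> erefl) (cB _ _ _ _ hx hz)) wNr !opprK.
  exact: (wBJ shomog0 shomogD sbracket_linr sbracket_linl sbracketC sbracketJ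
    deg_act_letter (hg _ _ hx) (hg _ _ hy) (hg _ _ hz) (cword_ops_linear x) (cword_ops_linear y)
      (cword_ops_linear z)
    (cword_ops_comm x) (cword_ops_comm y) (cword_ops_comm z) s).
- move=> x.
  have dd : linear (d \o d) by move=> c y z; rewrite /= !dl.
  have l0 : linear (fun _ : C => 0 : C) by move=> c y z; rewrite scaler0 addr0.
  apply: (eq_on_homog gC dd l0) => n {}x hx /=; apply: cochain_eq => s.
  have hx' : homog (susp C) (n + 1) x by rewrite /homog /= addrK.
  rewrite (cd _ _ (hd _ _ hx')) (eq_wd deg_br_letter _ _ _ (cd _ _ hx')).
  by rewrite wd_wd //; apply: cword_jacobi.
- move=> i j x y hx hy; apply: cochain_eq => s.
  rewrite (linD (cword_linear s)) (linZ (cword_linear s)) (cd _ _ (hB _ _ _ _ hx hy)).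
  rewrite (cB _ _ _ _ (hd _ _ hx) hy) (cB _ _ _ _ hx (hd _ _ hy)).
  rewrite (eq_wd deg_br_letter _ _ _ (cB _ _ _ _ hx hy)).
  rewrite (eq_wB _ _ _ _ _ _ (cd _ _ hx) (fun=> erefl)).
  rewrite (eq_wB _ _ _ _ _ _ (fun=> erefl) (cd _ _ hy)).
  have e : wd lam (i + j) (fun t => - wB i j (cword x) (cword y) t) s =
     - wd lam (i + j) (wB i j (cword x) (cword y)) s.
    rewrite /word_diff -scalerN; congr (_ *: _).
    rewrite -scaleN1r -qdZ; apply: (eq_qd deg_br_letter) => t _.
    by rewrite scaleN1r.
  rewrite e (wd_wB sbracket_linr sbracket_linl deg_act_letter deg_br_letter lam s
    (hg _ _ hx) (hg _ _ hy) (cword_ops_linear x) (cword_ops_linear y) (cword_ops_der x)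
      (cword_ops_der y)).
  by rewrite opprD scalerN.
Qed.
End Main.

Theorem theorem2p15 (K : fieldType) (char0 : [pchar K] =i pred0)
    (g h : sgLa K) (rho : g -> Der h) (rho_action : is_action rho)
    (lambda : K) :
  [/\ exists! d : cochain g h -> cochain g h, is_cochain_diff lambda d,
      exists! B : cochain g h -> cochain g h -> cochain g h,
        is_cochain_bracket rho B &
      forall (d : cochain g h -> cochain g h)
             (B : cochain g h -> cochain g h -> cochain g h),
        is_cochain_diff lambda d -> is_cochain_bracket rho B ->
        is_dgLa (L := susp (cochain g h)) B d].
Proof.
split.
- have [d hd] := exists_diff g h lambda.
  by exists d; split=> // d' hd'; apply: (diff_unique hd hd').
- have [B hB] := exists_bracket rho_action.
  by exists B; split=> // B' hB'; apply: (bracket_unique rho_action hB hB').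
- by move=> d B; apply: cochain_dgLa.
Qed.
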